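(* Consider the Quicksort recursive distributional equation $$X\stackrel d=UX_1+(1-U)X_2+C(U)\quad\text{on }\mathbb R,$$ where $C(x)=2x\log x+2(1-x)\log(1-x)+1$, $U$ is uniform on $[0,1]$, and $X_1,X_2$ are i.i.d. copies of $X$ independent of $U$. Let $\nu$ be its unique solution with mean zero and finite variance, let $m\in\mathbb R$, $\sigma\ge0$, and let $\mu=\nu*\mathrm{Cauchy}(m,\sigma^2)$. Then the invariant recursive tree process with marginal $\mu$ is endogenous if and only if $\sigma=0$.
   Context: $*$ denotes convolution. $\mathrm{Cauchy}(m,\sigma^2)$ denotes the distribution on $\mathbb R$ with characteristic function $t\mapsto\exp(imt-\sigma|t|)$ (for $\sigma=0$ this is the point mass at $m$). It is known that each such $\mu$ solves the equation. Recursive tree process: let $\mathbb T$ be the set of finite words in $\{1,2\}$ (root $\emptyset$, children $\mathbf i1,\mathbf i2$), $(U_{\mathbf i})_{\mathbf i\in\mathbb T}$ i.i.d. uniform on $[0,1]$. An invariant RTP with marginal $\mu$ is a family $(X_{\mathbf i})$ of random variables with law $\mu$ such that $X_{\mathbf i}=U_{\mathbf i}X_{\mathbf i1}+(1-U_{\mathbf i})X_{\mathbf i2}+C(U_{\mathbf i})$ a.s. for all $\mathbf i$ and, for each $d$, the generation-$d$ variables are i.i.d. and independent of $(U_{\mathbf i})$ at generations $<d$. It is endogenous if $X_\emptyset$ is $\sigma(U_{\mathbf i},\mathbf i\in\mathbb T)$-measurable. *)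

(* Defs.v *)
From HB Require Import structures.
From mathcomp Require Import all_boot all_order all_algebra.
From mathcomp Require Import all_classical all_reals all_analysis.
Set Implicit Arguments. Unset Strict Implicit. Unset Printing Implicit Defensive.
Import Order.TTheory GRing.Theory Num.Theory.
Import numFieldNormedType.Exports.
Local Open Scope classical_set_scope.
Local Open Scope ring_scope.

Section Defs.
Context (R : realType).

(* The Quicksort toll function C(x) = 2x log x + 2(1-x) log(1-x) + 1
   (ln 0 = 0 in MathComp-Analysis, giving the convention 0 log 0 = 0). *)
Definition qsC (x : R) : R := 2 * x * ln x + 2 * (1 - x) * ln (1 - x) + 1.

Definition quicksort_RDE_solution (nu : probability R R) : Prop :=
  forall A : set R, measurable A ->
    nu A = (\int[lebesgue_measure]_(u in `[0%R, 1%R]%classic)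
              \int[nu]_x1 \int[nu]_x2
                 (\1_A (u * x1 + (1 - u) * x2 + qsC u))%:E)%E.

(* Cauchy(m, sigma^2): characteristic function exp(imt - sigma|t|);
   point mass at m when sigma = 0, density sigma/(pi(sigma^2+(y-m)^2)) otherwise. *)
Definition cauchy_mass (m sigma : R) (B : set R) : \bar R :=
  if sigma == 0 then (\1_B m)%:E
  else (\int[lebesgue_measure]_(y in B)
          (sigma / (pi * (sigma ^+ 2 + (y - m) ^+ 2)))%:E)%E.

Definition conv_cauchy (nu : probability R R) (m sigma : R) (A : set R) : \bar R :=
  (\int[nu]_x cauchy_mass m sigma [set y | A (x + y)%R])%E.

Context (d : measure_display) (Omega : measurableType d) (P : probability Omega R).

Definition mutually_independent (I : eqType) (Z : I -> Omega -> R) (D : set I) : Prop :=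
  forall (J : seq I) (B : I -> set R),
    uniq J -> (forall j, j \in J -> D j) -> (forall j, measurable (B j)) ->
    P [set w | forall j, j \in J -> B j (Z j w)] =
    (\big[*%E/1%E]_(j <- J) P (Z j @^-1` B j))%E.

Definition independent_families (I I' : eqType) (Z : I -> Omega -> R) (D : set I)
    (Z' : I' -> Omega -> R) (D' : set I') : Prop :=
  forall (J : seq I) (B : I -> set R) (J' : seq I') (B' : I' -> set R),
    (forall j, j \in J -> D j) -> (forall j, measurable (B j)) ->
    (forall j, j \in J' -> D' j) -> (forall j, measurable (B' j)) ->
    let E := [set w | forall j, j \in J -> B j (Z j w)] in
    let E' := [set w | forall j, j \in J' -> B' j (Z' j w)] in
    P (E `&` E') = (P E * P E')%E.

(* Tree T = finite words over {1,2}, encoded as seq bool: child i1 is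
   rcons i false, child i2 is rcons i true, the root is [::],
   the generation of a word is its length. *)
Definition child1 (i : seq bool) := rcons i false.
Definition child2 (i : seq bool) := rcons i true.

Definition invariant_RTP (U X : seq bool -> Omega -> R) (mu : set R -> \bar R) : Prop :=
  (forall i, measurable_fun setT (U i)) /\
  (forall i A, measurable A ->
     P (U i @^-1` A) = lebesgue_measure (A `&` `[0%R, 1%R]%classic)) /\
  mutually_independent U setT /\
  (forall i, measurable_fun setT (X i)) /\
  (forall i A, measurable A -> P (X i @^-1` A) = mu A) /\
  (forall i, {ae P, forall w,
     X i w = U i w * X (child1 i) w + (1 - U i w) * X (child2 i) w + qsC (U i w)}) /\
  (forall n : nat,
     mutually_independent X [set i | size i = n] /\
     independent_families X [set i | size i = n] U [set i | (size i < n)%N]).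

Definition gen_sigma (U : seq bool -> Omega -> R) : set (set Omega) :=
  <<s [set E | exists i (B : set R), measurable B /\ E = U i @^-1` B] >>.

Definition endogenous (U X : seq bool -> Omega -> R) : Prop :=
  exists g : Omega -> R,
    (forall B : set R, measurable B -> gen_sigma U (g @^-1` B)) /\
    {ae P, forall w, X [::] w = g w}.

End Defs.

(* Main.v *)
(* Unrolling the recursion for [n] generations gives
   X_root = R_n + sum_(|i| = n) L_i X_i, where R_n and the weights L_i >= 0,
   sum_i L_i = 1, are functions of the U's of generation < n, independent of
   the X's of generation n.

   If sigma = 0 the X_i have mean m and finite variance v, so
   E (X_root - R_n - m)^2 = v * E (sum L_i^2) = v * (2/3)^n; this is summable,
   hence R_n + m converges to X_root almost surely.

   If sigma > 0, a lower bound for the Cauchy density on one period of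
   cos(s y + a) shows that the characteristic function of X_i has modulus at
   most 1 - c s for 0 <= s <= 1, so that conditionally on the first n
   generations the characteristic function of X_root at 1 has modulus at most
   prod_i (1 - c L_i) <= e^(-c).  Hence E[1_A (1 + cos(X_root + t))] is at most
   (1 + e^(-c)) P(A) for A measurable with respect to finitely many
   generations, and by a monotone class argument for every A in the sigma-field
   generated by the U's.  Were X_root measurable for the latter, the sets
   A = {cos(X_root + t) > (1 + e^(-c)) / 2} would all be null, but countably
   many of them cover the space. *)
Require Import Defs.
From HB Require Import structures.
From mathcomp Require Import all_boot all_order all_algebra.
From mathcomp Require Import all_classical all_reals all_analysis.
From mathcomp Require Import measurable_realfun.
From mathcomp Require Import ring lra.
Import Order.TTheory GRing.Theory Num.Theory.
Import numFieldNormedType.Exports.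
Local Open Scope classical_set_scope.
Local Open Scope ring_scope.
Set Implicit Arguments. Unset Strict Implicit. Unset Printing Implicit Defensive.

(** * Independence and iterated integrals *)

(** Both sides are finite measures in [E]; they agree on the pi-system [G], which contains [setT],
    hence on the sigma-algebra it generates. *)
Lemma indep_g_sigma_algebra (R : realType) d (Om : measurableType d) (P : probability Om R)
    (G : set (set Om)) (B : set Om) : setI_closed G -> G setT -> G `<=` measurable ->
  measurable B -> (forall E, G E -> P (E `&` B) = (P E * P B)%E) ->
  forall E, <<s G >> E -> P (E `&` B) = (P E * P B)%E.
Proof.
move=> GI GT Gm mB GB E sE.
have PB0 : (0 <= fine (P B))%R by exact: fine_ge0.
pose m1 : {measure set Om -> \bar R} := mrestr P mB.
pose m2 : {measure set Om -> \bar R} := mscale (NngNum PB0) P.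
have PBE : P B = (fine (P B))%:E by rewrite fineK// fin_num_measure.
have m2E A : m2 A = (P A * P B)%E by rewrite /m2 /= /mscale/= -PBE muleC.
rewrite -[LHS]/(m1 E) -m2E.
apply: (g_sigma_algebra_measure_unique G Gm (fun=> setT)) => //.
- by rewrite bigcup_const.
- by move=> A GA; rewrite m2E; exact: GB.
- by move=> _; rewrite -ge0_fin_numE//= /mrestr setTI fin_num_measure.
Qed.

(** Stands in for conditional expectation given the sigma-algebra generated by [G]: an independent
    [X] is integrated out with [w] frozen. The type of [f] forces it to see [w] through that
    sigma-algebra only. *)
Lemma indep_tonelli (R : realType) d (Om : measurableType d) (P : probability Om R)
    (G : set (set Om)) (X : {RV P >-> R}) :
  setI_closed G -> G setT -> G `<=` measurable ->
  (forall E B, G E -> measurable B -> P (E `&` X @^-1` B) = (P E * P (X @^-1` B))%E) ->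
  forall f : g_sigma_algebraType G * R -> \bar R,
    measurable_fun setT f -> (forall z, 0 <= f z)%E ->
  (\int[P]_w f (w, X w) = \int[P]_w \int[distribution P X]_x f (w, x))%E.
Proof.
move=> GI GT Gm GX f mf f0.
have sGm : <<s G >> `<=` measurable by exact: smallest_sub (@sigma_algebra_measurable _ Om) Gm.
(* The identity into the coarser space has as its law the restriction of [P]; independence says that
   the joint law of [idG] and [X] is a product, and Tonelli applies. *)
pose idG : Om -> g_sigma_algebraType G := fun w => w.
have midG : measurable_fun setT idG by move=> _ A mA; rewrite setTI; exact: sGm.
pose idM : {mfun Om >-> g_sigma_algebraType G} :=
  HB.pack idG (isMeasurableFun.Build _ _ _ _ _ midG).
pose PG := distribution P idM.
have mpair : measurable_fun setT (fun w => (idG w, X w)) by exact: measurable_fun_pair.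
pose pairM : {mfun Om >-> (g_sigma_algebraType G * R)%type} :=
  HB.pack (fun w => (idG w, X w)) (isMeasurableFun.Build _ _ _ _ _ mpair).
have E (Z : set (g_sigma_algebraType G * R)) : measurable Z ->
    (PG \x distribution P X)%E Z = distribution P pairM Z.
  apply: product_measure_unique => A B mA mB.
  apply: (@indep_g_sigma_algebra _ _ _ P G (X @^-1` B)) => //.
    by rewrite -[X in measurable X]setTI; exact: (measurable_funP X).
  by move=> E' GE'; exact: GX.
have -> : (\int[P]_w f (w, X w) = \int[distribution P pairM]_z f z)%E.
  by rewrite ge0_integral_distribution.
rewrite (eq_measure_integral (PG \x distribution P X)%E); last first.
  by move=> Z mZ _; exact/esym/E.
rewrite fubini_tonelli1//=.
rewrite ge0_integral_distribution//.
- exact: measurable_fun_fubini_tonelli_F.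
- by move=> y; exact: integral_ge0.
Qed.

(** * Cylinder events of a family of variables *)

Section rectangles.
Context (R : realType) d (Om : measurableType d) (I : eqType) (Z : I -> Om -> R).
Implicit Types (D : set I) (E : set Om).

(** A pi-system generating the sigma-algebra of the [Z j] with [D j]. Repeated indices in [J] are
    allowed, which makes stability under intersection a concatenation of lists. *)
Definition rect D : set (set Om) :=
  [set E | exists (J : seq I) (B : I -> set R),
    [/\ forall j, j \in J -> D j, forall j, measurable (B j) &
        E = [set w | forall j, j \in J -> B j (Z j w)]]].

Lemma rect_setT D : rect D setT.
Proof. by exists [::], (fun=> setT); split=> //; apply/seteqP; split. Qed.

Lemma rect_setI_closed D : setI_closed (rect D).
Proof.
move=> _ _ [J1 [B1 [D1 m1 ->]]] [J2 [B2 [D2 m2 ->]]].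
exists (J1 ++ J2), (fun j => (if j \in J1 then B1 j else setT) `&`
                             (if j \in J2 then B2 j else setT)); split.
- by move=> j; rewrite mem_cat => /orP[/D1|/D2].
- by move=> j; apply: measurableI; case: ifP.
- apply/seteqP; split=> w /=.
    by move=> [h1 h2] j _; split; case: ifP => // jJ; [exact: h1|exact: h2].
  move=> h; split=> j jJ.
    by have [] := h j; rewrite ?mem_cat jJ.
  by have [] := h j; rewrite ?mem_cat jJ ?orbT.
Qed.

Lemma rectS D D' : D `<=` D' -> rect D `<=` rect D'.
Proof.
by move=> DD' _ [J [B [JD mB ->]]]; exists J, B; split=> // j /JD; exact: DD'.
Qed.

Lemma rect_preimage D j B : D j -> measurable B -> rect D (Z j @^-1` B).
Proof.
move=> Dj mB; exists [:: j], (fun=> B); split=> //.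
  by move=> k; rewrite inE => /eqP ->.
apply/seteqP; split=> w /=; first by move=> h k; rewrite inE => /eqP ->.
by apply; rewrite inE.
Qed.

Lemma measurable_rect D j : D j ->
  measurable_fun (setT : set (g_sigma_algebraType (rect D))) (Z j).
Proof.
move=> Dj _ B mB; rewrite setTI.
by apply: sub_sigma_algebra; exact: rect_preimage.
Qed.

Hypothesis mZ : forall i, measurable_fun setT (Z i).

Lemma rect_measurable D : rect D `<=` measurable.
Proof.
move=> _ [J [B [JD mB ->]]]; elim: J {JD} => [|j J IH].
  by rewrite (_ : [set _ | _] = setT)//; apply/seteqP; split.
rewrite (_ : [set _ | _] = Z j @^-1` B j `&`
    [set w | forall j0, j0 \in J -> B j0 (Z j0 w)]).
  apply: measurableI => //; rewrite -[X in measurable X]setTI; exact: mZ.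
apply/seteqP; split=> w /=.
  by move=> h; split=> [|k kJ]; apply: h; rewrite inE ?eqxx// kJ orbT.
by move=> [hj h] k; rewrite inE => /orP[/eqP ->//|]; exact: h.
Qed.

Variable P : probability Om R.

Lemma mutually_independent_rect D S k E B : mutually_independent P Z D ->
  S `<=` D -> D k -> ~ S k -> rect S E -> measurable B ->
  P (E `&` Z k @^-1` B) = (P E * P (Z k @^-1` B))%E.
Proof.
move=> ind SD Dk Sk [J [C [JS mC ->]]] mB.
(* Mutual independence speaks of duplicate-free lists only, so [J] is reduced first; [k] is then put
   in front of it. *)
have kJ : k \notin undup J by rewrite mem_undup; apply/negP => /JS.
have -> : [set w | forall j, j \in J -> C j (Z j w)] =
          [set w | forall j, j \in undup J -> C j (Z j w)].
  by apply/seteqP; split=> w /= h j jJ; apply: h; move: jJ; rewrite mem_undup.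
rewrite [in RHS]ind ?undup_uniq//; last first.
  by move=> j; rewrite mem_undup => /JS /SD.
pose C' j := if j == k then B else C j.
have C'E j : j \in undup J -> C' j = C j.
  by rewrite /C'; case: eqP => // ->; rewrite (negbTE kJ).
rewrite (_ : _ `&` _ = [set w | forall j, j \in k :: undup J -> C' j (Z j w)]).
  rewrite ind //=; last 3 first.
  - by rewrite kJ undup_uniq.
  - by move=> j; rewrite inE mem_undup => /orP[/eqP ->//|/JS /SD].
  - by move=> j; rewrite /C'; case: ifP.
  rewrite big_cons muleC /C' eqxx; congr (_ * _)%E.
  by apply: eq_big_seq => j /C'E; rewrite /C' => ->.
apply/seteqP; split=> w /=.
  move=> [h hk] j; rewrite inE => /orP[/eqP ->|jJ]; first by rewrite /C' eqxx.
  by rewrite C'E//; exact: h.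
move=> h; split=> [j jJ|].
  by rewrite -C'E//; apply: h; rewrite inE jJ orbT.
by have := h k; rewrite /C' eqxx; apply; rewrite inE eqxx.
Qed.

End rectangles.

Section tree_family.
Context (R : realType) d (Om : measurableType d) (P : probability Om R).
Variables U X : seq bool -> Om -> R.

(** Joining the [U]'s and the [X]'s in one family lets a single [rect] describe the early
    generations of [U] together with some of the [X]'s of generation [n]. *)
Definition tree_family (x : seq bool + seq bool) : Om -> R :=
  match x with inl i => U i | inr i => X i end.

Definition tree_dom (n : nat) (S : set (seq bool)) : set (seq bool + seq bool) :=
  [set x | match x with inl i => (size i < n)%N | inr i => S i end].

(** A cylinder event splits into an [X] part and a [U] part. The [U] part factors out by
    independence of the two families, and [X k] then separates from the other [X]'s within its
    generation. *)
Lemma tree_family_indep n S k E B :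
  mutually_independent P X [set i | size i = n] ->
  independent_families P X [set i | size i = n] U [set i | (size i < n)%N] ->
  S `<=` [set i | size i = n] -> size k = n -> ~ S k ->
  rect tree_family (tree_dom n S) E -> measurable B ->
  P (E `&` X k @^-1` B) = (P E * P (X k @^-1` B))%E.
Proof.
move=> indX indXU Sn kn Sk [J [C [JS mC ->]]] mB.
pose JU := pmap (fun x : seq bool + seq bool => if x is inl i then Some i else None) J.
pose JX := pmap (fun x : seq bool + seq bool => if x is inr i then Some i else None) J.
have memJU i : (i \in JU) = (inl i \in J).
  rewrite mem_pmap; apply/mapP/idP => [[[j|j] jJ]//= [->]//|h].
  by exists (inl i).
have memJX i : (i \in JX) = (inr i \in J).
  rewrite mem_pmap; apply/mapP/idP => [[[j|j] jJ]//= [->]//|h].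
  by exists (inr i).
pose EU := [set w | forall j, j \in JU -> C (inl j) (U j w)].
pose EX := [set w | forall j, j \in JX -> C (inr j) (X j w)].
have -> : [set w | forall j, j \in J -> C j (tree_family j w)] = EX `&` EU.
  apply/seteqP; split=> w /=.
    by move=> h; split=> j; rewrite (memJU, memJX) => /h.
  by move=> [hX hU] [i|i] iJ; [apply: hU; rewrite memJU|apply: hX; rewrite memJX].
have JXS j : j \in JX -> S j by rewrite memJX => /JS.
have JUS j : j \in JU -> (size j < n)%N by rewrite memJU => /JS.
have EXE : rect X S EX by exists JX, (fun j => C (inr j)).
have EXk : rect X [set i | size i = n] (EX `&` X k @^-1` B).
  by apply: rect_setI_closed; [exact: (rectS Sn EXE)|exact: rect_preimage].
have indE E' : rect X [set i | size i = n] E' -> P (E' `&` EU) = (P E' * P EU)%E.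
  by move=> [J' [C' [J'S mC' ->]]]; exact: (indXU J' C' JU (fun j => C (inl j))).
rewrite setIAC indE// (indE EX); last exact: (rectS Sn EXE).
by rewrite (mutually_independent_rect indX Sn)// muleAC.
Qed.

End tree_family.

(** * The weights of the tree *)

Section weights.
Context (R : realType).

(** The [U i] lie in the unit interval only almost surely; clamping makes the weights nonnegative
    with sum one at every point. *)
Definition clamp (x : R) : R := Num.max 0 (Num.min 1 x).

Lemma clamp_ge0 x : 0 <= clamp x. Proof. by rewrite /clamp le_max lexx. Qed.

Lemma clamp_le1 x : clamp x <= 1.
Proof. by rewrite /clamp ge_max ler01 ge_min lexx. Qed.

Lemma clamp_id x : 0 <= x <= 1 -> clamp x = x.
Proof. by case/andP=> x0 x1; rewrite /clamp (min_r x1) (max_r x0). Qed.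

Lemma measurable_clamp : measurable_fun setT clamp.
Proof.
apply: measurable_maxr; first exact: measurable_cst.
by apply: measurable_minr => //; exact: measurable_cst.
Qed.

Fixpoint words n : seq (seq bool) :=
  if n is n'.+1 then [seq rcons i false | i <- words n'] ++
                     [seq rcons i true | i <- words n'] else [:: [::]].

Lemma size_words n i : i \in words n -> size i = n.
Proof.
elim: n i => [|n IH] i /=; first by rewrite inE => /eqP ->.
by rewrite mem_cat => /orP[] /mapP[j /IH jn ->]; rewrite size_rcons jn.
Qed.

Lemma uniq_words n : uniq (words n).
Proof.
elim: n => //= n IH; rewrite cat_uniq !map_inj_uniq ?IH ?andbT//=; last 2 first.
- by move=> i j /rcons_inj[].
- by move=> i j /rcons_inj[].
by apply/hasPn => _ /mapP[i _ ->]; apply/mapP => -[j _ /rcons_inj[]].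
Qed.

Lemma big_words n (V : nmodType) (F : seq bool -> V) :
  \sum_(i <- words n.+1) F i =
  \sum_(i <- words n) (F (rcons i false) + F (rcons i true)).
Proof. by rewrite /= big_cat/= !big_map big_split. Qed.

Context (Om : Type) (U : seq bool -> Om -> R).

Definition coef (b : bool) (u : R) : R := if b then 1 - clamp u else clamp u.

(** The weight L_i, a product along the path from the root. It involves [U] at the strict ancestors
    of [i] only, hence in generations below [size i]. *)
Definition wt (i : seq bool) (w : Om) : R :=
  \prod_(k < size i) coef (nth false i k) (U (take k i) w).

Lemma wt_rcons i b w : wt (rcons i b) w = wt i w * coef b (U i w).
Proof.
rewrite /wt size_rcons big_ord_recr/= nth_rcons ltnn eqxx.
rewrite -cats1 take_size_cat//; congr (_ * _).
by apply: eq_bigr => k _; rewrite nth_cat ltn_ord takel_cat// ltnW.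
Qed.

Lemma wt_nil w : wt [::] w = 1. Proof. by rewrite /wt big_ord0. Qed.

Lemma coef_ge0 b u : 0 <= coef b u.
Proof. by case: b; rewrite /coef ?clamp_ge0// subr_ge0 clamp_le1. Qed.

Lemma wt_ge0 i w : 0 <= wt i w.
Proof. by apply: prodr_ge0 => k _; exact: coef_ge0. Qed.

Lemma sum_wt n w : \sum_(i <- words n) wt i w = 1.
Proof.
elim: n => [|n IH]; first by rewrite big_seq1 wt_nil.
rewrite big_words -[RHS]IH; apply: eq_bigr => i _.
by rewrite !wt_rcons -mulrDr /coef addrC subrK mulr1.
Qed.

Lemma wt_le1 n i w : i \in words n -> wt i w <= 1.
Proof.
move=> iw; rewrite -(sum_wt n w) (big_rem i)//= lerDl.
by apply: sumr_ge0 => j _; exact: wt_ge0.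
Qed.

Definition toll n (w : Om) : R :=
  \sum_(k < n) \sum_(i <- words k) wt i w * qsC (U i w).

(** By induction, each value of generation [n] is replaced by its two children and a toll. The
    hypothesis on [U] removes the clamping. *)
Lemma tree_expansion (X : seq bool -> Om -> R) w :
  (forall i, 0 <= U i w <= 1) ->
  (forall i, X i w = U i w * X (child1 i) w + (1 - U i w) * X (child2 i) w
                     + qsC (U i w)) ->
  forall n, X [::] w = toll n w + \sum_(i <- words n) wt i w * X i w.
Proof.
move=> U01 XE; elim=> [|n IH].
  by rewrite /toll big_ord0 add0r big_seq1 wt_nil mul1r.
rewrite IH /toll big_ord_recr/= -addrA; congr (_ + _).
rewrite [in RHS]big_words -big_split/=; apply: eq_bigr => i _.
by rewrite !wt_rcons /coef clamp_id// {1}XE /child1 /child2; ring.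
Qed.

End weights.

Arguments coef {R} b u : simpl never.

Section weights_measurable.
Context (R : realType) d (Om : measurableType d).

Lemma measurable_coef b : measurable_fun setT (@coef R b).
Proof.
case: b; rewrite /coef; last exact: measurable_clamp.
by apply: measurable_funB; [exact: measurable_cst|exact: measurable_clamp].
Qed.

Lemma measurable_qsC : measurable_fun setT (@qsC R).
Proof.
have ml (f : R -> R) : measurable_fun setT f ->
    measurable_fun setT (fun x => 2 * f x * ln (f x)).
  move=> mf; apply: measurable_funM.
    by apply: measurable_funM => //; exact: measurable_cst.
  by apply: measurableT_comp mf; exact: measurable_ln.
apply: measurable_funD; last exact: measurable_cst.
apply: measurable_funD; first exact: ml.
by apply: (ml (fun x => 1 - x)); apply: measurable_funB => //; exact: measurable_cst.
Qed.

Variable U : seq bool -> Om -> R.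

(** Only the [U j] of generation below [n] are assumed measurable, so that [Om] may carry the
    sigma-algebra which they generate. *)
Lemma measurable_wt n i : (size i <= n)%N ->
  (forall j, (size j < n)%N -> measurable_fun setT (U j)) ->
  measurable_fun setT (wt U i).
Proof.
move=> sin mU.
apply: measurable_prod => k _.
apply: measurableT_comp; first exact: measurable_coef.
apply: mU; rewrite size_take ltn_ord.
exact: leq_trans (ltn_ord k) sin.
Qed.

Lemma measurable_sum_seq (I : eqType) (s : seq I) (h : I -> Om -> R) :
  (forall i, i \in s -> measurable_fun setT (h i)) ->
  measurable_fun setT (fun w => \sum_(i <- s) h i w).
Proof.
elim: s => [|i s IH] mh.
  by under eq_fun do rewrite big_nil; exact: measurable_cst.
under eq_fun do rewrite big_cons.
apply: measurable_funD; first by apply: mh; rewrite inE eqxx.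
by apply: IH => j js; apply: mh; rewrite inE js orbT.
Qed.

Lemma measurable_toll n :
  (forall j, (size j < n)%N -> measurable_fun setT (U j)) ->
  measurable_fun setT (toll U n).
Proof.
move=> mU; rewrite /toll; under eq_fun do rewrite -(big_mkord xpredT
  (fun k => \sum_(i <- words k) wt U i _ * qsC (U i _))).
apply: measurable_sum_seq => k; rewrite mem_index_iota => kn.
apply: measurable_sum_seq => i /size_words ik.
apply: measurable_funM; first by apply: measurable_wt mU; rewrite ik ltnW.
by apply: measurableT_comp; [exact: measurable_qsC|apply: mU; rewrite ik].
Qed.

End weights_measurable.

(** * Second moments and the case sigma = 0 *)

Lemma FTC2_derive (R : realType) (f F : R -> R) (a b : R) : a < b ->
  (forall x : R, is_derive x 1 F (f x)) -> continuous f ->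
  (\int[lebesgue_measure]_(x in `[a, b]) (f x)%:E = (F b)%:E - (F a)%:E)%E.
Proof.
move=> ab dF cf.
have cF : continuous F.
  by move=> x; apply/differentiable_continuous/derivable1_diffP; have [] := dF x.
apply: continuous_FTC2 => //.
- exact: continuous_subspaceT.
- split; first by move=> x _; have [] := dF x.
  + by apply: cvg_at_right_filter; exact: cF.
  + by apply: cvg_at_left_filter; exact: cF.
- by move=> x _; rewrite derive1E; have [_ ->] := dF x.
Qed.

Lemma integral_coef_sq (R : realType) :
  (\int[lebesgue_measure]_(u in `[0%R, 1%R])
     ((coef false u) ^+ 2 + (coef true u) ^+ 2 : R)%:E = (2 / 3)%:E)%E.
Proof.
transitivity (\int[lebesgue_measure]_(u in `[0%R, 1%R]) (u ^+ 2 + (1 - u) ^+ 2 : R)%:E)%E.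
  apply: eq_integral => u; rewrite inE/= in_itv/= => u01.
  by rewrite /coef clamp_id.
(* An antiderivative, increasing by 1/3 + 1/3 over the unit interval. *)
pose F (u : R) : R := u ^+ 3 / 3 - (1 - u) ^+ 3 / 3.
have dF (x : R) : is_derive x 1 F (x ^+ 2 + (1 - x) ^+ 2).
  rewrite /F; apply: is_derive_eq => /=.
  rewrite /GRing.scale/=. field; split; rewrite pnatr_eq0.
have cf : continuous (fun x : R => x ^+ 2 + (1 - x) ^+ 2).
  by move=> x; exact/differentiable_continuous/derivable1_diffP.
rewrite (FTC2_derive ltr01 dF cf) -EFinD /F; congr (_%:E); field; split; rewrite pnatr_eq0.
Qed.

Lemma ge0_integral_mrestr d (T : measurableType d) (R : realType)
    (mu : {measure set T -> \bar R}) (D : set T) (mD : measurable D)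
    (f : T -> \bar R) : measurable_fun setT f -> (forall x, 0 <= f x)%E ->
  (\int[mrestr mu mD]_x f x = \int[mu]_(x in D) f x)%E.
Proof.
move=> mf f0.
have D0 : mrestr mu mD (~` D) = 0%E by rewrite /mrestr/= setICl measure0.
rewrite [LHS](ge0_negligible_integral (measurableC mD) measurableT mf _ D0)//.
rewrite setTD setCK; apply: eq_measure_integral => A mA AD.
by rewrite -[RHS](congr1 mu (setIidl AD)).
Qed.

Section lebesgue_bridge.
Variable R : realType.

(* [lebesgue_measure] lives on [measurableTypeR R], whose display differs from
   the one of [R] as a measurable type although the measurable sets agree. *)
Definition idR (x : measurableTypeR R) : R := x.

Lemma measurable_idR : measurable_fun setT idR.
Proof. by move=> _ A mA; rewrite setTI. Qed.

HB.instance Definition _ := isMeasurableFun.Build _ _ _ _ idR measurable_idR.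

Lemma ge0_integral_uniform (Q : probability R R) (f : R -> \bar R) :
  (forall A : set R, measurable A ->
     Q A = lebesgue_measure (A `&` `[0%R, 1%R]%classic)) ->
  measurable_fun setT f -> (forall x, 0 <= f x)%E ->
  (\int[Q]_x f x = \int[lebesgue_measure]_(x in `[0%R, 1%R]) f x)%E.
Proof.
move=> QE mf f0.
have mI : measurable (`[0%R, 1%R]%classic : set (measurableTypeR R)).
  exact: measurable_itv.
pose mu := mrestr lebesgue_measure mI.
transitivity (\int[pushforward mu idR]_x f x)%E.
  by apply: eq_measure_integral => A mA _; exact: QE.
by rewrite ge0_integral_pushforward// ge0_integral_mrestr.
Qed.

End lebesgue_bridge.

Section law.
Context (R : realType) d (Om : measurableType d) (P : probability Om R).
Variables (Y : Om -> R) (mY : measurable_fun setT Y).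

Definition law : probability R R :=
  distribution P (HB.pack Y (isMeasurableFun.Build _ _ _ _ _ mY) : {mfun Om >-> R}).

Lemma indep_tonelli_law (G : set (set Om)) :
  setI_closed G -> G setT -> G `<=` measurable ->
  (forall E B, G E -> measurable B -> P (E `&` Y @^-1` B) = (P E * P (Y @^-1` B))%E) ->
  forall f : g_sigma_algebraType G * R -> \bar R,
    measurable_fun setT f -> (forall z, 0 <= f z)%E ->
  (\int[P]_w f (w, Y w) = \int[P]_w \int[law]_x f (w, x))%E.
Proof. by move=> *; exact: indep_tonelli. Qed.

End law.

(** * Second moments of the weighted sums *)

Section variance.
Context (R : realType) d (Om : measurableType d) (P : probability Om R).
Variables U X : seq bool -> Om -> R.
Hypothesis mU : forall i, measurable_fun setT (U i).
Hypothesis mX : forall i, measurable_fun setT (X i).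
Hypothesis lawU : forall i A, measurable A ->
  P (U i @^-1` A) = lebesgue_measure (A `&` `[0%R, 1%R]%classic).
Hypothesis indU : mutually_independent P U setT.
Hypothesis indX : forall n, mutually_independent P X [set i | size i = n].
Hypothesis indXU : forall n,
  independent_families P X [set i | size i = n] U [set i | (size i < n)%N].

Let mwt i : measurable_fun setT (wt U i).
Proof. by apply: (measurable_wt (n := size i)). Qed.

Lemma integral_law_coef_sq i :
  (\int[law P (mU i)]_u (coef false u ^+ 2 + coef true u ^+ 2)%:E = (2 / 3)%:E)%E.
Proof.
rewrite -integral_coef_sq; apply: ge0_integral_uniform.
- by move=> A mA; exact: lawU.
- by apply/measurable_EFinP/measurable_funD; apply: measurable_funX; exact: measurable_coef.
- by move=> u; rewrite lee_fin addr_ge0 ?sqr_ge0.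
Qed.

(** The weight of [i] depends on [U] at shorter words, so it is independent of [U i], and
    integrating [U i] out leaves the factor 2/3. *)
Lemma integral_wt_children i :
  (\int[P]_w (wt U (rcons i false) w ^+ 2 + wt U (rcons i true) w ^+ 2)%:E =
   (2 / 3)%:E * \int[P]_w (wt U i w ^+ 2)%:E)%E.
Proof.
pose S := [set j : seq bool | (size j < size i)%N].
pose f (z : g_sigma_algebraType (rect U S) * R) : \bar R :=
  (wt U i z.1 ^+ 2 * (coef false z.2 ^+ 2 + coef true z.2 ^+ 2))%:E.
transitivity (\int[P]_w f (w, U i w))%E.
  by apply: eq_integral => w _; rewrite !wt_rcons /f /coef/=; congr (_%:E); ring.
have mwS : measurable_fun (setT : set (g_sigma_algebraType (rect U S))) (wt U i).
  by apply: (measurable_wt (n := size i)) => // j ji; exact: measurable_rect.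
rewrite (indep_tonelli_law (mU i) (@rect_setI_closed _ _ _ _ _ _)
  (@rect_setT _ _ _ _ _ _))//; first last.
- move=> z; rewrite lee_fin mulr_ge0 ?sqr_ge0// addr_ge0 ?sqr_ge0//.
- apply/measurable_EFinP; apply: measurable_funM.
    by apply: measurable_funX; apply: measurableT_comp mwS _; exact: measurable_fst.
  by apply: measurable_funD; apply: measurable_funX;
    apply: measurableT_comp (@measurable_coef R _) _; exact: measurable_snd.
- move=> E B ES mB; apply: (mutually_independent_rect indU (S := S)) => //.
  by rewrite /S/= ltnn.
- exact: rect_measurable.
rewrite -ge0_integralZl//; last 2 first.
- by apply/measurable_EFinP/measurable_funX.
- by move=> w _; rewrite lee_fin sqr_ge0.
apply: eq_integral => w _; rewrite /f/=.
under eq_integral do rewrite EFinM.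
rewrite ge0_integralZl//; last 3 first.
- by apply/measurable_EFinP/measurable_funD; apply: measurable_funX; exact: measurable_coef.
- by move=> u _; rewrite lee_fin addr_ge0 ?sqr_ge0.
- by rewrite lee_fin sqr_ge0.
by rewrite integral_law_coef_sq muleC.
Qed.

Lemma sum_integral_wt_sq n :
  (\sum_(i <- words n) \int[P]_w (wt U i w ^+ 2)%:E = ((2 / 3) ^+ n)%:E)%E.
Proof.
elim: n => [|n IH].
  rewrite big_seq1 (eq_integral (cst 1%E)); last first.
    by move=> w _; rewrite wt_nil expr1n.
  by rewrite integral_cst// mul1e expr0; exact: probability_setT.
rewrite big_words exprS EFinM -IH ge0_sume_distrr; last first.
  by move=> i _; apply: integral_ge0 => w _; rewrite lee_fin sqr_ge0.
apply: eq_bigr => i _; rewrite -integral_wt_children -ge0_integralD//.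
- by move=> w _; rewrite lee_fin sqr_ge0.
- by apply/measurable_EFinP/measurable_funX.
- by move=> w _; rewrite lee_fin sqr_ge0.
- by apply/measurable_EFinP/measurable_funX.
Qed.

Variables m v : R.
Hypothesis v0 : 0 <= v.
(** Mean [m] and variance [v] expressed through integrals of squares alone: the cross term vanishes
    inside the formula, and Tonelli for nonnegative functions suffices later. *)
Hypothesis varX : forall i a l,
  (\int[law P (mX i)]_x ((a + l * (x - m)) ^+ 2)%:E = (a ^+ 2 + v * l ^+ 2)%:E)%E.

(** The terms are peeled off one by one. The remaining sum [T] and the weight of [k] are measurable
    for [G], of which [X k] is independent, so [varX] applies with [a] the value of [T] and [l] the
    weight. *)
Lemma integral_sq_sum n (s : seq (seq bool)) : uniq s ->
  (forall i, i \in s -> size i = n) ->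
  (\int[P]_w ((\sum_(i <- s) wt U i w * (X i w - m)) ^+ 2)%:E =
   \sum_(i <- s) v%:E * \int[P]_w (wt U i w ^+ 2)%:E)%E.
Proof.
elim: s => [|k s IH] /=.
  move=> _ _; rewrite big_nil; under eq_integral do rewrite big_nil expr0n/=.
  by rewrite integral0.
move=> /andP[ks us] sn.
have kn : size k = n by apply: sn; rewrite inE eqxx.
have {}sn i : i \in s -> size i = n by move=> i_s; apply: sn; rewrite inE i_s orbT.
rewrite big_cons -IH// => {IH}.
pose G := rect (tree_family U X) (tree_dom n [set i | i \in s]).
have mG : forall x, measurable_fun setT (tree_family U X x) by case.
have mwG i : (size i <= n)%N ->
    measurable_fun (setT : set (g_sigma_algebraType G)) (wt U i).
  move=> i_n; apply: (measurable_wt (n := n)) => // j jn.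
  exact: (@measurable_rect _ _ _ _ (tree_family U X) _ (inl j)).
pose T w := \sum_(i <- s) wt U i w * (X i w - m).
have mT : measurable_fun (setT : set (g_sigma_algebraType G)) T.
  apply: measurable_sum_seq => i i_s; apply: measurable_funM.
    by apply: mwG; rewrite sn.
  apply: measurable_funB; last exact: measurable_cst.
  exact: (@measurable_rect _ _ _ _ (tree_family U X) _ (inr i)).
have mT' : measurable_fun setT T.
  apply: measurable_sum_seq => i i_s; apply: measurable_funM => //.
  by apply: measurable_funB; last exact: measurable_cst.
pose f (z : g_sigma_algebraType G * R) : \bar R :=
  ((T z.1 + wt U k z.1 * (z.2 - m)) ^+ 2)%:E.
transitivity (\int[P]_w f (w, X k w))%E.
  by apply: eq_integral => w _; rewrite /f/= big_cons addrC.
rewrite (indep_tonelli_law (mX k) (@rect_setI_closed _ _ _ _ _ _)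
  (@rect_setT _ _ _ _ _ _))//; first last.
- by move=> z; rewrite lee_fin sqr_ge0.
- apply/measurable_EFinP; apply: measurable_funX; apply: measurable_funD.
    by apply: measurableT_comp mT _; exact: measurable_fst.
  apply: measurable_funM.
    by apply: measurableT_comp; [apply: mwG; rewrite kn|exact: measurable_fst].
  by apply: measurable_funB; [exact: measurable_snd|exact: measurable_cst].
- move=> E B ES mB.
  apply: (tree_family_indep (@indX n) (@indXU n) (S := [set i | i \in s])) ES mB => //.
  exact/negP.
- exact: rect_measurable.
transitivity (\int[P]_w ((T w ^+ 2)%:E + v%:E * (wt U k w ^+ 2)%:E))%E.
  by apply: eq_integral => w _; rewrite -EFinM -EFinD -(varX k).
rewrite ge0_integralD//.
- rewrite addeC ge0_integralZl//.
  + by apply/measurable_EFinP/measurable_funX.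
  + by move=> w _; rewrite lee_fin sqr_ge0.
- by move=> w _; rewrite lee_fin sqr_ge0.
- by apply/measurable_EFinP/measurable_funX.
- by move=> w _; rewrite mule_ge0// lee_fin sqr_ge0.
- by apply/measurable_funeM/measurable_EFinP/measurable_funX.
Qed.

Lemma integral_sq_words n :
  (\int[P]_w ((\sum_(i <- words n) wt U i w * (X i w - m)) ^+ 2)%:E =
   (v * (2 / 3) ^+ n)%:E)%E.
Proof.
rewrite (@integral_sq_sum n) ?uniq_words//; last exact: size_words.
rewrite EFinM -sum_integral_wt_sq ge0_sume_distrr//.
by move=> i _; apply: integral_ge0 => w _; rewrite lee_fin sqr_ge0.
Qed.

End variance.

Lemma cvg_sq0 (R : realType) (u : R^nat) : (u n ^+ 2) @[n --> \oo] --> 0 ->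
  u @ \oo --> 0.
Proof.
move=> u2; apply/norm_cvg0P.
rewrite (_ : (fun _ => _) = Num.sqrt \o (fun n => u n ^+ 2)); last first.
  by apply/funext => n /=; rewrite sqrtr_sqr.
by rewrite -[X in _ --> X]sqrtr0; exact: (continuous_cvg _ (@sqrt_continuous R 0) u2).
Qed.

(** The series of the squares has expectation at most v / (1 - r), so it is almost surely finite and
    its terms tend to 0. *)
Lemma ae_cvg0_of_integral_sq (R : realType) d (Om : measurableType d)
    (P : probability Om R) (D : nat -> Om -> R) (v r : R) :
  0 <= v -> 0 <= r < 1 -> (forall n, measurable_fun setT (D n)) ->
  (forall n, \int[P]_w (D n w ^+ 2)%:E = (v * r ^+ n)%:E)%E ->
  {ae P, forall w, D n w @[n --> \oo] --> 0}.
Proof.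
move=> v0 /andP[r0 r1] mD ID.
have mD2 n : measurable_fun setT (fun w => (D n w ^+ 2)%:E).
  by apply/measurable_EFinP/measurable_funX.
pose g w := (\sum_(n <oo) (D n w ^+ 2)%:E)%E.
have g0 w : (0 <= g w)%E.
  by apply: nneseries_ge0 => n _ _; rewrite lee_fin sqr_ge0.
have mg : measurable_fun setT g.
  by apply: ge0_emeasurable_sum => // n w _ _; rewrite lee_fin sqr_ge0.
have : P.-integrable setT g.
  apply/integrableP; split => //.
  under eq_integral do rewrite gee0_abs//.
  rewrite integral_nneseries//; last by move=> n w _; rewrite lee_fin sqr_ge0.
  apply: (@le_lt_trans _ _ (v / (1 - r))%:E); last exact: ltry.
  apply: lime_le.
    apply: is_cvg_nneseries => n _ _; rewrite ID lee_fin mulr_ge0// exprn_ge0//.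
  apply: nearW => n; under eq_bigr do rewrite ID.
  rewrite sumEFin lee_fin.
  have -> : \sum_(0 <= i < n) (v * r ^+ i) = series (geometric v r) n by [].
  rewrite geometric_seriesE ?lt_eqF//.
  rewrite ler_pM2r ?invr_gt0 ?subr_gt0// ler_piMr// gerBl exprn_ge0//.
move=> /(integrable_ae measurableT); apply: filterS => w /(_ I) gfin.
apply: cvg_sq0; apply: cvg_series_cvg_0; apply: nondecreasing_is_cvgn.
  apply/nondecreasing_seqP => n; rewrite seriesSr lerDl sqr_ge0//.
exists (fine (g w)) => _ [n _ <-].
rewrite -lee_fin fineK// -sumEFin.
by apply: nneseries_lim_ge => k _ _; rewrite lee_fin sqr_ge0.
Qed.

Lemma ae_forall_countable (R : realType) d (Om : measurableType d)
    (P : probability Om R) (I : countType) (Q : I -> Om -> Prop) :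
  (forall i, {ae P, forall w, Q i w}) -> {ae P, forall w, forall i, Q i w}.
Proof.
move=> aeQ.
(* The property is transported to the natural numbers; integers that code no index carry the trivial
   statement. *)
have : {ae P, forall w, forall n, if @unpickle I n is Some i then Q i w else True}.
  apply: ae_foralln => n; case: unpickle => [i|]; first exact: aeQ.
  by apply: aeW.
by apply: filterS => w h i; have := h (pickle i); rewrite pickleK.
Qed.

Lemma integral_sq_affine (R : realType) (nu : probability R R) :
  nu.-integrable setT (fun x => x%:E) -> (\int[nu]_x x%:E = 0)%E ->
  (\int[nu]_x (x ^+ 2)%:E < +oo)%E -> forall a l : R,
  (\int[nu]_x ((a + l * x) ^+ 2)%:E =
   (a ^+ 2 + fine (\int[nu]_x (x ^+ 2)%:E) * l ^+ 2)%:E)%E.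
Proof.
move=> i1 m0 v a l.
have i2 : nu.-integrable setT (fun x => (x ^+ 2)%:E).
  apply/integrableP; split; first exact/measurable_EFinP/measurable_funX.
  by under eq_integral do rewrite gee0_abs ?lee_fin ?sqr_ge0//.
have vfin : (\int[nu]_x (x ^+ 2)%:E \is a fin_num)%E.
  by rewrite ge0_fin_numE// integral_ge0// => x _; rewrite lee_fin sqr_ge0.
have i0 : nu.-integrable setT (fun=> (a ^+ 2)%:E).
  exact: finite_measure_integrable_cst.
have i1' : nu.-integrable setT (fun x => (2 * a * l)%:E * x%:E)%E.
  exact: integrableZl.
have i2' : nu.-integrable setT (fun x => (l ^+ 2)%:E * (x ^+ 2)%:E)%E.
  exact: integrableZl.
transitivity (\int[nu]_x ((a ^+ 2)%:E +
    ((2 * a * l)%:E * x%:E + (l ^+ 2)%:E * (x ^+ 2)%:E)))%E.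
  by apply: eq_integral => x _; rewrite -!EFinM -!EFinD; congr (_%:E); ring.
rewrite integralD//; last exact: integrableD.
rewrite integralD// !integralZl// m0 mule0 add0e integral_cst//.
rewrite EFinD (EFinM (fine _)) fineK//; congr (_ + _)%E; last first.
  by rewrite muleC.
by rewrite -[RHS]mule1; congr (_ * _)%E; exact: probability_setT.
Qed.

Lemma measurable_preimageT d d' (T : measurableType d) (T' : measurableType d')
    (f : T -> T') (A : set T') : measurable_fun setT f -> measurable A ->
  measurable (f @^-1` A).
Proof. by move=> mf mA; rewrite -[X in measurable X]setTI; exact: mf. Qed.

Lemma conv_cauchy0 (R : realType) (nu : probability R R) m (A : set R) :
  measurable A -> conv_cauchy nu m 0 A = nu ((fun x => x + m) @^-1` A).
Proof.
move=> mA.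
have ms : measurable_fun setT (fun x : R => x + m).
  by apply: measurable_funD => //; exact: measurable_cst.
rewrite /conv_cauchy /cauchy_mass eqxx -[X in _ = nu X]setIT -integral_indic//.
  exact: measurable_preimageT.
Qed.

(** * Endogeny without a Cauchy component *)

Section sigma0.
Context (R : realType) d (Om : measurableType d) (P : probability Om R).
Variables U X : seq bool -> Om -> R.

(** The tree being countable, one event of full measure serves all its nodes. *)
Lemma ae_tree (mu : set R -> \bar R) : invariant_RTP P U X mu ->
  {ae P, forall w, (forall i, 0 <= U i w <= 1) /\
    (forall i, X i w = U i w * X (child1 i) w + (1 - U i w) * X (child2 i) w
                       + qsC (U i w))}.
Proof.
move=> [mU [lawU [_ [_ [_ [XE _]]]]]].
have U01 i : {ae P, forall w, 0 <= U i w <= 1}.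
  have mI : measurable (`[0%R, 1%R]%classic : set R) by exact: measurable_itv.
  exists (U i @^-1` ~` `[0%R, 1%R]); split.
  - by apply: measurable_preimageT => //; exact: measurableC.
  - by rewrite lawU ?setICl ?measure0//; exact: measurableC.
  - by move=> w /= h; rewrite in_itv.
move: (ae_forall_countable U01) (ae_forall_countable XE).
by apply: filterS2.
Qed.

Lemma endogenous0 (nu : probability R R) m :
  nu.-integrable setT (fun x => x%:E) -> (\int[nu]_x x%:E = 0)%E ->
  (\int[nu]_x (x ^+ 2)%:E < +oo)%E ->
  invariant_RTP P U X (conv_cauchy nu m 0) -> endogenous P U X.
Proof.
move=> i1 m0 v0 H; have aeT := ae_tree H.
case: H => [mU [lawU [indU [mX [lawX [_ indXX]]]]]].
pose v := fine (\int[nu]_x (x ^+ 2)%:E).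
have v_ge0 : 0 <= v.
  by apply: fine_ge0; apply: integral_ge0 => x _; rewrite lee_fin sqr_ge0.
have varX i a l : (\int[law P (mX i)]_x ((a + l * (x - m)) ^+ 2)%:E =
                   (a ^+ 2 + v * l ^+ 2)%:E)%E.
  have ms : measurable_fun setT (fun x : R => x + m).
    by apply: measurable_funD => //; exact: measurable_cst.
  rewrite -(integral_sq_affine i1 m0 v0).
  (* For [sigma] zero the law of [X i] is [nu] translated by [m]. *)
  transitivity (\int[law nu ms]_x ((a + l * (x - m)) ^+ 2)%:E)%E.
    apply: eq_measure_integral => A mA _.
    exact: etrans (lawX i A mA) (conv_cauchy0 nu m mA).
  rewrite ge0_integral_distribution//.
  - by apply: eq_integral => x _ /=; rewrite addrK.
  - apply/measurable_EFinP/measurable_funX/measurable_funD; first exact: measurable_cst.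
    apply: measurable_funM; first exact: measurable_cst.
    by apply: measurable_funB => //; exact: measurable_cst.
  - by move=> x; rewrite lee_fin sqr_ge0.
pose D n w := \sum_(i <- words n) wt U i w * (X i w - m).
have ID n : (\int[P]_w (D n w ^+ 2)%:E = (v * (2 / 3) ^+ n)%:E)%E.
  by apply: integral_sq_words => // k; have [] := indXX k.
have mD n : measurable_fun setT (D n).
  apply: measurable_sum_seq => i _; apply: measurable_funM.
    exact: (measurable_wt (n := size i)).
  by apply: measurable_funB => //; exact: measurable_cst.
have r01 : 0 <= (2 / 3 : R) < 1 by lra.
have D0 := ae_cvg0_of_integral_sq v_ge0 r01 mD ID.
pose GU := [set E | exists i (B : set R), measurable B /\ E = U i @^-1` B].
have mUG i : measurable_fun (setT : set (g_sigma_algebraType GU)) (U i).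
  by move=> _ B mB; rewrite setTI; apply: sub_sigma_algebra; exists i, B.
(* An upper limit is measurable for the [U]'s everywhere, also where the sequence diverges; [fine]
   sends infinite values to 0. Almost surely it is the limit of R_n + m. *)
pose g (w : g_sigma_algebraType GU) : R :=
  fine (limn_esup (fun n => (toll U n w + m)%:E)).
have mg : measurable_fun setT g.
  apply: measurableT_comp; first exact: fine_measurable.
  apply: measurable_fun_limn_esup => n; apply/measurable_EFinP.
  apply: measurable_funD; last exact: measurable_cst.
  by apply: measurable_toll => j _; exact: mUG.
exists g; split.
  by move=> B mB; rewrite -[_ @^-1` _]setTI; exact: mg.
move: aeT D0; apply: filterS2 => w [U01 XE] Dw.
(* Since the weights sum to one, centring each [X i] at [m] subtracts exactly [m]. *)
rewrite /g (_ : (fun n => _) = EFin \o (fun n => X [::] w - D n w)); last first.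
  apply/funext => n /=; congr (_%:E).
  rewrite (tree_expansion U01 XE n) /D.
  have -> : \sum_(i <- words n) wt U i w * (X i w - m) =
            \sum_(i <- words n) wt U i w * X i w - m.
    under eq_bigr do rewrite mulrBr.
    by rewrite sumrB -mulr_suml sum_wt mul1r.
  by ring.
have cv : (EFin \o (fun n => X [::] w - D n w)) @ \oo --> (X [::] w)%:E.
  apply: cvg_EFin; first by apply: nearW.
  rewrite -[X in _ --> X]subr0; apply: cvgB; [exact: cvg_cst|exact: Dw].
by rewrite is_cvg_limn_esupE; [rewrite (cvg_lim _ cv)|apply/cvg_ex; eexists; exact: cv].
Qed.

End sigma0.

(** * Characteristic functions *)

Section trigonometric.
Context (R : realType).
Implicit Types p q r x : R.

Lemma measurable_cos : measurable_fun setT (@cos R).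
Proof. by apply: continuous_measurable_fun; exact: continuous_cos. Qed.

Lemma measurable_sin : measurable_fun setT (@sin R).
Proof. by apply: continuous_measurable_fun; exact: continuous_sin. Qed.

(** Cauchy-Schwarz, with the defect written as a square. It supplies the nonnegativity that Tonelli
    needs below. *)
Lemma trig_lb p q r x : 0 <= r -> p ^+ 2 + q ^+ 2 <= r ^+ 2 ->
  0 <= r + (p * cos x + q * sin x).
Proof.
move=> r0 pq.
suff h : `|p * cos x + q * sin x| <= r by move: h; rewrite ler_norml => /andP[h _]; lra.
rewrite -ler_sqr ?nnegrE// real_normK ?num_real//.
apply: le_trans pq; rewrite -subr_ge0.
have -> : p ^+ 2 + q ^+ 2 - (p * cos x + q * sin x) ^+ 2 = (p * sin x - q * cos x) ^+ 2.
  rewrite -[p ^+ 2 + q ^+ 2]mulr1 -[in LHS](cos2Dsin2 x); ring.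
exact: sqr_ge0.
Qed.

(** The interval is one full period, over which the trigonometric part integrates to zero whatever
    the shift [y]. *)
Lemma integral_trig_period p q s y a : 0 < s ->
  (\int[lebesgue_measure]_(x in `[a, (a + 2 * pi / s)%R])
     (1 - (p * cos (s * (y + x)) + q * sin (s * (y + x))))%:E
   = (2 * pi / s)%:E)%E.
Proof.
move=> s0.
pose F x := x - (p * (s^-1 * sin (s * (y + x))) - q * (s^-1 * cos (s * (y + x)))).
have s_neq0 : s != 0 by rewrite gt_eqF.
have dF (x : R) : is_derive x 1 F
    (1 - (p * cos (s * (y + x)) + q * sin (s * (y + x)))).
  rewrite /F; apply: is_derive_eq => /=.
  rewrite /GRing.scale/=; field; exact: s_neq0.
have cf : continuous (fun x => 1 - (p * cos (s * (y + x)) + q * sin (s * (y + x)))).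
  by move=> x; exact/differentiable_continuous/derivable1_diffP.
rewrite (FTC2_derive _ dF cf); last by rewrite ltrDl divr_gt0// mulr_gt0// pi_gt0.
rewrite -EFinD /F; congr (_%:E).
have -> : s * (y + (a + 2 * pi / s)) = s * (y + a) + pi *+ 2.
  by rewrite -mulr_natl; field; exact: s_neq0.
rewrite sinD2pi cosD2pi; ring.
Qed.

End trigonometric.

(** * Minorizing the Cauchy density by a constant on a window *)

Section cauchy_window.
Context (R : realType) (nu : probability R R) (m sigma : R).
Hypothesis sigma_gt0 : 0 < sigma.

Let dens (y : R) : R := sigma / (pi * (sigma ^+ 2 + (y - m) ^+ 2)).

Let den_gt0 y : 0 < pi * (sigma ^+ 2 + (y - m) ^+ 2).
Proof. by rewrite mulr_gt0 ?pi_gt0// ltr_wpDr ?sqr_ge0// exprn_gt0. Qed.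

Let measurable_dens : measurable_fun setT dens.
Proof.
apply: continuous_measurable_fun => x.
have h : pi * (sigma ^+ 2 + (x - m) ^+ 2) != 0 by rewrite gt_eqF.
by apply/differentiable_continuous/derivable1_diffP.
Qed.

Variable T : R.
Hypothesis T_gt0 : 0 < T.

Let W : set (measurableTypeR R) := `[m, m + T]%classic.
Let mW : measurable W. Proof. exact: measurable_itv. Qed.
Let Woo : (lebesgue_measure W < +oo)%E.
Proof. by rewrite /W lebesgue_measure_itv/=; case: ifP => _; rewrite -?EFinD ltry. Qed.
(** The density at distance [T] from its centre [m], thus its minimum over the window [W]. *)
Let c0 : R := sigma / (pi * (sigma ^+ 2 + T ^+ 2)).
Let c0_ge0 : 0 <= c0.
Proof.
by rewrite divr_ge0 ?(ltW sigma_gt0)// mulr_ge0 ?pi_ge0// addr_ge0 ?sqr_ge0.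
Qed.

Lemma cauchy_mass_window (B : set R) : measurable B ->
  (c0%:E * mfrestr mW Woo B <= cauchy_mass m sigma B)%E.
Proof.
move=> mB; rewrite /cauchy_mass gt_eqF//.
have mBW : measurable (B `&` W) by exact: measurableI.
apply: (@le_trans _ _ (\int[lebesgue_measure]_(y in B `&` W) (dens y)%:E)%E).
  rewrite -[leLHS]/(c0%:E * lebesgue_measure (B `&` W))%E -integral_cst//.
  apply: ge0_le_integral => //.
  - by apply/measurable_EFinP; apply: measurable_funTS.
  - move=> y [_]; rewrite /W/= in_itv/= => /andP[my yT].
    rewrite lee_fin /c0 /dens ler_pM2l// lef_pV2 ?posrE//; last first.
      by rewrite mulr_gt0 ?pi_gt0// addr_gt0 ?exprn_gt0.
    rewrite ler_pM2l ?pi_gt0// lerD2l ler_sqr ?nnegrE ?subr_ge0 ?(ltW T_gt0)//.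
    by rewrite lerBlDl.
apply: ge0_subset_integral => //.
- by apply/measurable_EFinP; apply: measurable_funTS.
- by move=> y _; rewrite lee_fin ltW// divr_gt0.
Qed.

Let add2 (z : R * measurableTypeR R) : R := z.1 + z.2.
Let madd2 : measurable_fun setT add2.
Proof.
apply: measurable_funD; first exact: measurable_fst.
exact: measurableT_comp (@measurable_idR R) (@measurable_snd _ _ _ _).
Qed.

(** The image of [nu] times Lebesgue measure on [W] under addition, scaled by [c0], is dominated by
    [Q] on every measurable set, hence also for integrals of nonnegative functions. *)
Lemma integral_conv_cauchy_window (Q : probability R R) (h : R -> R) :
  (forall A, measurable A -> Q A = conv_cauchy nu m sigma A) ->
  measurable_fun setT h -> (forall x, 0 <= h x) ->
  (c0%:E * \int[nu]_x \int[lebesgue_measure]_(y in W) (h (x + y))%:E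
   <= \int[Q]_x (h x)%:E)%E.
Proof.
move=> QE mh h0.
pose lW := mfrestr mW Woo.
pose mu2 := (nu \x lW)%E.
pose add2M : {mfun (R * measurableTypeR R)%type >-> R} :=
  HB.pack add2 (isMeasurableFun.Build _ _ _ _ _ madd2).
pose mu'_ : {measure set R -> \bar R} := mscale (NngNum c0_ge0) (pushforward mu2 add2M).
pose mu' := mu'_ (measurable_funP add2M).
have le_mu'A A : measurable A -> (mu' A <= Q A)%E.
  move=> mA; rewrite QE//.
  have mxs (x : R) : measurable [set y : R | A (x + y)].
    apply: (measurable_preimageT (f := fun y => x + y)) => //.
    by apply: measurable_funD => //; exact: measurable_cst.
  have madd2A : measurable (add2 @^-1` A) by exact: measurable_preimageT.
  have -> : mu' A = (c0%:E * \int[nu]_x lW (xsection (add2 @^-1` A) x))%E by [].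
  rewrite -ge0_integralZl//; last exact: measurable_fun_xsection.
  apply: ge0_le_integral => //.
  - by move=> x _; rewrite mule_ge0.
  - by apply: measurable_funeM; exact: measurable_fun_xsection.
  (* Measurability in [x] of the translated Cauchy mass: it is a partial integral of a nonnegative
     function on the product. *)
  - rewrite [X in measurable_fun _ X](_ : _ = fubini_F lebesgue_measure
        (fun z => (dens z.2 * \1_(add2 @^-1` A) z)%:E)); last first.
      apply/funext => x; rewrite /cauchy_mass gt_eqF// integral_mkcond /fubini_F.
      apply: eq_integral => y _; rewrite patchE indicE; case: ifPn => h1.
        by rewrite mem_set ?mulr1//; rewrite inE in h1.
      by rewrite memNset ?mulr0//; rewrite notin_setE in h1.
    apply: measurable_fun_fubini_tonelli_F => //.
    + apply/measurable_EFinP; apply: measurable_funM; last exact: measurable_indic.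
      apply: measurableT_comp measurable_dens _.
      exact: measurableT_comp (@measurable_idR R) (@measurable_snd _ _ _ _).
    + by move=> z; rewrite lee_fin mulr_ge0// ltW// divr_gt0.
  - move=> x _; rewrite xsectionE; exact: (cauchy_mass_window (mxs x)).
have le_mu' : (\int[mu']_x (h x)%:E <= \int[Q]_x (h x)%:E)%E.
  by apply: ge0_le_measure_integral => //; exact/measurable_EFinP.
apply: le_trans le_mu'.
have mhE : measurable_fun setT (EFin \o h) by exact/measurable_EFinP.
have mh2 : measurable_fun setT ((EFin \o h) \o add2) by exact: measurableT_comp.
rewrite /mu' ge0_integral_mscale//; last by move=> x _; rewrite lee_fin.
rewrite lee_wpmul2l//.
rewrite ge0_integral_pushforward//; last by move=> y _; rewrite lee_fin.
apply: le_trans (_ : (\int[nu]_x \int[lW]_y (h (x + y))%:E <= _)%E); last first.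
  have h20 z : (0 <= ((EFin \o h) \o add2) z)%E by rewrite lee_fin.
  by have := fubini_tonelli1 (m1 := nu) (m2 := lW) _ mh2 h20; rewrite /fubini_F => <-.
rewrite le_eqVlt; apply/orP; left; apply/eqP; apply: eq_integral => x _.
apply/esym; apply: ge0_integral_mrestr => [|y]; last by rewrite lee_fin.
apply/measurable_EFinP; apply: (measurableT_comp mh).
by apply: measurable_funD; [exact: measurable_cst|exact: measurable_idR].
Qed.

End cauchy_window.

Section characteristic.
Context (R : realType) (Q : probability R R).

(** Real part of the characteristic function, [sin_transform] being the imaginary part; complex
    numbers are avoided throughout. *)
Definition cos_transform (s : R) : R := fine (\int[Q]_x (cos (s * x))%:E)%E.
Definition sin_transform (s : R) : R := fine (\int[Q]_x (sin (s * x))%:E)%E.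

Lemma integrable_bounded (f : R -> R) (M : R) : measurable_fun setT f ->
  (forall x, `|f x| <= M) -> Q.-integrable setT (EFin \o f).
Proof.
move=> mf fM; apply: measurable_bounded_integrable => //.
  by rewrite (@le_lt_trans _ _ 1%E) ?ltry// probability_le1.
by exists M; split; [exact: num_real|move=> x Mx y _; exact: le_trans (fM y) (ltW Mx)].
Qed.

Let measurable_mul s : measurable_fun setT (fun x : R => s * x).
Proof. by apply: measurable_funM => //; exact: measurable_cst. Qed.

Let icos s : Q.-integrable setT (fun x => (cos (s * x))%:E).
Proof.
apply: (integrable_bounded (M := 1)) => [|x]; last exact: cos_max.
exact: measurableT_comp (@measurable_cos R) (measurable_mul s).
Qed.

Let isin s : Q.-integrable setT (fun x => (sin (s * x))%:E).
Proof.
apply: (integrable_bounded (M := 1)) => [|x]; last exact: sin_max.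
exact: measurableT_comp (@measurable_sin R) (measurable_mul s).
Qed.

Lemma integral_trig (K p q s : R) :
  (\int[Q]_x (K + (p * cos (s * x) + q * sin (s * x)))%:E =
   (K + (p * cos_transform s + q * sin_transform s))%:E)%E.
Proof.
have iK : Q.-integrable setT (fun=> K%:E) by exact: finite_measure_integrable_cst.
have ip : Q.-integrable setT (fun x => p%:E * (cos (s * x))%:E)%E by exact: integrableZl.
have iq : Q.-integrable setT (fun x => q%:E * (sin (s * x))%:E)%E by exact: integrableZl.
transitivity (\int[Q]_x (K%:E + (p%:E * (cos (s * x))%:E + q%:E * (sin (s * x))%:E)))%E.
  by [].
rewrite integralD//; last exact: integrableD.
rewrite integralD// !integralZl//.
rewrite 2!EFinD (EFinM p) (EFinM q) !fineK ?integrable_fin_num//.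
rewrite integral_cst//; congr (_ + _)%E.
by rewrite -[RHS]mule1; congr (_ * _)%E; exact: probability_setT.
Qed.

Lemma measurable_trig_transform (p q : R) : measurable_fun setT
  (fun s => p * cos_transform s + q * sin_transform s).
Proof.
(* Adding [K] makes the integrand nonnegative, so Tonelli yields measurability in [s], where random
   weights will be substituted; [K] is subtracted at the end. *)
pose K : R := `|p| + `|q|.
pose f (z : R * R) : \bar R := (K + (p * cos (z.1 * z.2) + q * sin (z.1 * z.2)))%:E.
have mz : measurable_fun setT (fun z : R * R => z.1 * z.2).
  by apply: measurable_funM; [exact: measurable_fst|exact: measurable_snd].
have mf : measurable_fun setT f.
  apply/measurable_EFinP; apply: measurable_funD; first exact: measurable_cst.
  apply: measurable_funD; apply: measurable_funM; try exact: measurable_cst.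
    exact: measurableT_comp (@measurable_cos R) mz.
  exact: measurableT_comp (@measurable_sin R) mz.
have f0 z : (0 <= f z)%E.
  rewrite lee_fin; apply: trig_lb; first by rewrite addr_ge0.
  by rewrite -(real_normK (num_real p)) -(real_normK (num_real q)) /K
    sqrrD addrAC lerDl mulrn_wge0// mulr_ge0.
have := measurable_fun_fubini_tonelli_F (m2 := Q) f mf f0.
rewrite (_ : fubini_F Q f = (fun s =>
    (K + (p * cos_transform s + q * sin_transform s))%:E)); last first.
  by apply/funext => s; rewrite -integral_trig.
move=> /measurable_EFinP mF.
rewrite (_ : (fun s => _) = (fun s => (K + (p * cos_transform s + q * sin_transform s)) - K)).
  by apply: measurable_funB mF _; exact: measurable_cst.
by apply/funext => s; rewrite addrAC subrr add0r.
Qed.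

Lemma measurable_cos_transform : measurable_fun setT cos_transform.
Proof.
have := measurable_trig_transform 1 0.
by under eq_fun do rewrite mul1r mul0r addr0.
Qed.

Lemma measurable_sin_transform : measurable_fun setT sin_transform.
Proof.
have := measurable_trig_transform 0 1.
by under eq_fun do rewrite mul1r mul0r add0r.
Qed.

End characteristic.

(** With pi for [p], the right side is the constant [c0] times the length 2 pi / s of the window. It
    simplifies to the left side with [sigma] replaced by [s * sigma] in the denominator, and [s] is
    at most one. *)
Lemma window_mass (R : realType) (sigma s p : R) : 0 < sigma -> 0 < s -> s <= 1 ->
  0 < p -> 2 * sigma / (sigma ^+ 2 + (2 * p) ^+ 2) * s <=
    sigma / (p * (sigma ^+ 2 + (2 * p / s) ^+ 2)) * (2 * p / s).
Proof.
move=> sigma0 s0 s1 p0.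
have h : 0 < (s * sigma) ^+ 2 + (2 * p) ^+ 2.
  by rewrite addr_gt0// exprn_gt0// mulr_gt0.
have h' : 0 < sigma ^+ 2 + (2 * p) ^+ 2.
  by rewrite addr_gt0// exprn_gt0// mulr_gt0.
have -> : sigma / (p * (sigma ^+ 2 + (2 * p / s) ^+ 2)) * (2 * p / s) =
          2 * sigma / ((s * sigma) ^+ 2 + (2 * p) ^+ 2) * s.
  by field; rewrite !gt_eqF//= ?(lt_le_trans h)// lerD2r exprMn.
rewrite ler_pM2r// ler_pM2l ?mulr_gt0// lef_pV2 ?posrE// lerD2r exprMn.
by rewrite ler_piMl ?sqr_ge0// expr_le1// ltW.
Qed.

(** The characteristic function is tested against every unit vector; the one aligned with it yields
    the bound on the modulus. *)
Lemma conv_cauchy_transform (R : realType) (nu Q : probability R R) (m sigma s : R) :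
  0 < sigma ->
  (forall A, measurable A -> Q A = conv_cauchy nu m sigma A) ->
  0 <= s <= 1 ->
  let c := 2 * sigma / (sigma ^+ 2 + (2 * pi) ^+ 2) in
  c * s <= 1 /\
  cos_transform Q s ^+ 2 + sin_transform Q s ^+ 2 <= (1 - c * s) ^+ 2.
Proof.
move=> sigma0 QE /andP[s0 s1] c.
set al := cos_transform Q s; set be := sin_transform Q s.
have pi0 : 0 < pi :> R := pi_gt0 R.
have key p q : p ^+ 2 + q ^+ 2 = 1 -> c * s <= 1 - (p * al + q * be).
  move=> pq.
  have h0 (x : R) : 0 <= 1 - (p * cos x + q * sin x).
    rewrite opprD -!mulNr; apply: trig_lb => //.
    by rewrite !sqrrN pq expr1n.
  have E : (\int[Q]_x (1 - (p * cos (s * x) + q * sin (s * x)))%:E =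
            (1 - (p * al + q * be))%:E)%E.
    rewrite opprD -!mulNr -integral_trig; apply: eq_integral => x _.
    by rewrite opprD -!mulNr.
  (* At [s] zero there is no period, and nonnegativity is enough. *)
  move: s0; rewrite le_eqVlt => /orP[/eqP s0|s0].
    rewrite -lee_fin -E -s0 mulr0; apply: integral_ge0 => x _.
    by rewrite lee_fin.
  have T0 : 0 < 2 * pi / s by rewrite divr_gt0// mulr_gt0.
  have mh : measurable_fun setT (fun x => 1 - (p * cos (s * x) + q * sin (s * x))).
    apply: continuous_measurable_fun => x.
    by apply/differentiable_continuous/derivable1_diffP.
  have := integral_conv_cauchy_window sigma0 T0 QE mh (fun x => h0 (s * x)).
  have -> : (\int[nu]_x \int[lebesgue_measure]_(y in `[m, (m + 2 * pi / s)%R])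
      (1 - (p * cos (s * (x + y)) + q * sin (s * (x + y))))%:E =
      (2 * pi / s)%:E)%E.
    under eq_integral do rewrite integral_trig_period//.
    by rewrite integral_cst// -[RHS]mule1; congr (_ * _)%E; exact: probability_setT.
  by rewrite E -EFinM lee_fin; apply: le_trans; exact: window_mass.
(* If the modulus is zero no direction is distinguished, and the vector (1, 0) gives
   [c * s <= 1]. *)
have [r0|r0] := eqVneq (al ^+ 2 + be ^+ 2) 0.
  have := key 1 0; rewrite expr1n expr0n/= addr0 => /(_ erefl).
  have /andP[/eqP al0 _] : (al == 0) && (be == 0).
    by rewrite -(sqrf_eq0 al) -(sqrf_eq0 be) -paddr_eq0 ?sqr_ge0// r0.
  rewrite al0 mulr0 mul0r addr0 subr0 => h; split => //.
  by move: r0; rewrite al0 => ->; rewrite sqr_ge0.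
pose r := Num.sqrt (al ^+ 2 + be ^+ 2).
have r2 : r ^+ 2 = al ^+ 2 + be ^+ 2 by rewrite sqr_sqrtr// addr_ge0 ?sqr_ge0.
have r_gt0 : 0 < r by rewrite sqrtr_gt0 lt_neqAle eq_sym r0 addr_ge0 ?sqr_ge0.
have := key (al / r) (be / r).
rewrite !expr_div_n -mulrDl -r2 divff ?expf_neq0 ?gt_eqF// => /(_ erefl).
have -> : al / r * al + be / r * be = r.
  have -> : al / r * al + be / r * be = (al ^+ 2 + be ^+ 2) / r by ring.
  by rewrite -r2 expr2 mulfK// gt_eqF.
move=> h; split; first by lra.
by rewrite ler_sqr ?nnegrE; lra.
Qed.

Lemma measurable_fun_g_sigma_sub (T : pointedType) d' (T' : measurableType d')
    (G G' : set (set T)) (f : T -> T') : G `<=` G' ->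
  measurable_fun (setT : set (g_sigma_algebraType G)) f ->
  measurable_fun (setT : set (g_sigma_algebraType G')) f.
Proof.
move=> GG' mf _ B mB; apply: (sub_sigma_algebra2 GG').
exact: (mf measurableT).
Qed.

Lemma rect_tree_family (R : realType) d (Om : measurableType d)
    (U X : seq bool -> Om -> R) n S :
  rect U [set j | (size j < n)%N] `<=` rect (tree_family U X) (tree_dom n S).
Proof.
move=> _ [J [B [JS mB ->]]].
exists [seq inl j | j <- J], (fun x => if x is inl j then B j else setT); split.
- by move=> _ /mapP[j jJ ->]; exact: JS.
- by case.
- apply/seteqP; split=> w /= h.
    by move=> _ /mapP[j jJ ->]; exact: h.
  by move=> j jJ; apply: (h (inl j)); apply: map_f.
Qed.

Lemma g_sigma_rect_measurable (R : realType) d (Om : measurableType d)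
    (I : eqType) (Z : I -> Om -> R) (D : set I) :
  (forall i, measurable_fun setT (Z i)) -> <<s rect Z D >> `<=` measurable.
Proof.
move=> mZ; apply: smallest_sub; first exact: sigma_algebra_measurable.
exact: rect_measurable.
Qed.

Lemma measurable_fun_rect (R : realType) d (Om : measurableType d)
    (I : eqType) (Z : I -> Om -> R) (D : set I) (f : Om -> R) :
  (forall i, measurable_fun setT (Z i)) ->
  measurable_fun (setT : set (g_sigma_algebraType (rect Z D))) f ->
  measurable_fun setT f.
Proof.
move=> mZ mf _ B mB; rewrite setTI; apply: (g_sigma_rect_measurable mZ).
by rewrite -[_ @^-1` _]setTI; exact: mf.
Qed.

(** * Integrating out a generation, one value at a time *)

Section peeling.
Context (R : realType) d (Om : measurableType d) (P : probability Om R).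
Variables U X : seq bool -> Om -> R.
Hypothesis mU : forall i, measurable_fun setT (U i).
Hypothesis mX : forall i, measurable_fun setT (X i).
Variable n : nat.
Hypothesis indX : mutually_independent P X [set i | size i = n].
Hypothesis indXU :
  independent_families P X [set i | size i = n] U [set i | (size i < n)%N].
Variable c : R.
Hypothesis c_ge0 : 0 <= c.
Hypothesis transformX : forall i s, 0 <= s <= 1 -> c * s <= 1 /\
  cos_transform (law P (mX i)) s ^+ 2 + sin_transform (law P (mX i)) s ^+ 2
    <= (1 - c * s) ^+ 2.

Let G := rect U [set j | (size j < n)%N].

Let mG (f : Om -> R) : measurable_fun (setT : set (g_sigma_algebraType G)) f ->
  measurable_fun setT f.
Proof. exact: measurable_fun_rect. Qed.

Let mwt i : size i = n -> measurable_fun (setT : set (g_sigma_algebraType G)) (wt U i).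
Proof.
move=> i_n; apply: (measurable_wt (n := n)); first by rewrite i_n.
by move=> j jn; exact: measurable_rect.
Qed.

(** Integrating [X k] out multiplies a + ib by the conjugate characteristic function of [X k] at the
    weight of [k], so the modulus bound [r] gains a factor 1 - c L_k. [K] stays fixed and dominates
    [r], which keeps all integrands nonnegative. *)
Lemma integral_trig_peel (s : seq (seq bool)) (K a b r : Om -> R) : uniq s ->
  (forall i, i \in s -> i \in words n) ->
  measurable_fun (setT : set (g_sigma_algebraType G)) K ->
  measurable_fun (setT : set (g_sigma_algebraType G)) a ->
  measurable_fun (setT : set (g_sigma_algebraType G)) b ->
  measurable_fun (setT : set (g_sigma_algebraType G)) r ->
  (forall w, 0 <= r w <= K w) -> (forall w, a w ^+ 2 + b w ^+ 2 <= r w ^+ 2) ->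
  (\int[P]_w (K w + (a w * cos (\sum_(i <- s) wt U i w * X i w) +
                     b w * sin (\sum_(i <- s) wt U i w * X i w)))%:E <=
   \int[P]_w (K w + r w * \prod_(i <- s) (1 - c * wt U i w))%:E)%E.
Proof.
elim: s a b r => [|k s IH] a b r us sw mK ma mb mr rK abr.
  apply: ge0_le_integral => //.
  - move=> w _; rewrite lee_fin big_nil cos0 sin0 mulr1 mulr0 addr0.
    have := @trig_lb R (a w) (b w) (r w) 0 _ (abr w).
    rewrite cos0 sin0 mulr1 mulr0 addr0.
    by have /andP[r0 rKw] := rK w => /(_ r0); lra.
  - apply/measurable_EFinP; under eq_fun do rewrite big_nil cos0 sin0 mulr1 mulr0 addr0.
    by apply: measurable_funD; exact: mG.
  - apply/measurable_EFinP; under eq_fun do rewrite big_nil mulr1.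
    by apply: measurable_funD; exact: mG.
  - move=> w _; rewrite lee_fin !big_nil cos0 sin0 !mulr1 mulr0 addr0 lerD2l.
    have /andP[r0 _] := rK w.
    apply: le_trans (ler_norm _) _; rewrite -ler_sqr ?nnegrE// real_normK ?num_real//.
    by apply: le_trans (abr w); rewrite lerDl sqr_ge0.
move: us => /= /andP[ks us].
have kw : k \in words n by apply: sw; rewrite inE eqxx.
have kn := size_words kw.
have {}sw i : i \in s -> i \in words n by move=> h; apply: sw; rewrite inE h orbT.
(* The sum over [s] is measurable for the larger [G'] only, whereas the coefficients must stay
   measurable for [G] for the induction to continue. *)
pose G' := rect (tree_family U X) (tree_dom n [set i | i \in s]).
have mG' (f : Om -> R) : measurable_fun (setT : set (g_sigma_algebraType G)) f ->
    measurable_fun (setT : set (g_sigma_algebraType G')) f.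
  by apply: measurable_fun_g_sigma_sub; exact: rect_tree_family.
pose S w := \sum_(i <- s) wt U i w * X i w.
have mS : measurable_fun (setT : set (g_sigma_algebraType G')) S.
  apply: measurable_sum_seq => i i_s; apply: measurable_funM.
    by apply: mG'; apply: mwt; apply: size_words; exact: sw.
  exact: (@measurable_rect _ _ _ _ (tree_family U X) _ (inr i)).
have mcS : measurable_fun (setT : set (g_sigma_algebraType G')) (cos \o S).
  exact: measurableT_comp (@measurable_cos R) mS.
have msS : measurable_fun (setT : set (g_sigma_algebraType G')) (sin \o S).
  exact: measurableT_comp (@measurable_sin R) mS.
(* By the addition formulas, [p] and [q] are the coefficients of the cosine and sine of the term in
   [k]. *)
pose p w := a w * cos (S w) + b w * sin (S w).
pose q w := b w * cos (S w) - a w * sin (S w).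
have mp : measurable_fun (setT : set (g_sigma_algebraType G')) p.
  by apply: measurable_funD; apply: measurable_funM => //; exact: mG'.
have mq : measurable_fun (setT : set (g_sigma_algebraType G')) q.
  by apply: measurable_funB; apply: measurable_funM => //; exact: mG'.
have pq w : p w ^+ 2 + q w ^+ 2 = a w ^+ 2 + b w ^+ 2.
  rewrite -[RHS]mulr1 -(cos2Dsin2 (S w)) /p /q; ring.
pose f (z : g_sigma_algebraType G' * R) : \bar R :=
  (K z.1 + (p z.1 * cos (wt U k z.1 * z.2) + q z.1 * sin (wt U k z.1 * z.2)))%:E.
have m1 (h : Om -> R) : measurable_fun (setT : set (g_sigma_algebraType G')) h ->
    measurable_fun setT (fun z : g_sigma_algebraType G' * R => h z.1).
  by move=> mh; apply: measurableT_comp mh _; exact: measurable_fst.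
have mwx : measurable_fun setT (fun z : g_sigma_algebraType G' * R => wt U k z.1 * z.2).
  apply: measurable_funM; last exact: measurable_snd.
  by apply: m1; apply: mG'; exact: mwt.
have mf : measurable_fun setT f.
  apply/measurable_EFinP; apply: measurable_funD; first by apply: m1; exact: mG'.
  apply: measurable_funD; apply: measurable_funM; try exact: m1.
    exact: measurableT_comp (@measurable_cos R) mwx.
  exact: measurableT_comp (@measurable_sin R) mwx.
have f0 z : (0 <= f z)%E.
  rewrite lee_fin; have /andP[r0 rKw] := rK z.1; apply: trig_lb.
    exact: le_trans rKw.
  by rewrite pq; apply: le_trans (abr _) _; rewrite ler_sqr ?nnegrE// (le_trans r0).
have -> : (\int[P]_w (K w + (a w * cos (\sum_(i <- k :: s) wt U i w * X i w) +
                     b w * sin (\sum_(i <- k :: s) wt U i w * X i w)))%:E =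
    \int[P]_w f (w, X k w))%E.
  apply: eq_integral => w _; rewrite big_cons /f/= -/(S w) cosD sinD /p /q.
  by congr (_%:E); ring.
rewrite (indep_tonelli_law (mX k) (@rect_setI_closed _ _ _ _ _ _)
  (@rect_setT _ _ _ _ _ _))//; first last.
- move=> E B ES mB.
  apply: (tree_family_indep (indX) (indXU) (S := [set i | i \in s])) ES mB => //.
    by move=> i /sw /size_words.
  exact/negP.
- by apply: rect_measurable; case.
pose al w := cos_transform (law P (mX k)) (wt U k w).
pose be w := sin_transform (law P (mX k)) (wt U k w).
have mal : measurable_fun (setT : set (g_sigma_algebraType G)) al.
  by apply: measurableT_comp (measurable_cos_transform _) _; exact: mwt.
have mbe : measurable_fun (setT : set (g_sigma_algebraType G)) be.
  by apply: measurableT_comp (measurable_sin_transform _) _; exact: mwt.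
(* Regrouped around the cosine and sine of [S], the new coefficients depend on [U] alone again. *)
have -> : (\int[P]_w \int[law P (mX k)]_x f (w, x) =
    \int[P]_w (K w + ((a w * al w + b w * be w) * cos (S w) +
                      (b w * al w - a w * be w) * sin (S w)))%:E)%E.
  apply: eq_integral => w _.
  transitivity (K w + (p w * al w + q w * be w))%:E; last first.
    by rewrite /p /q; congr (_%:E); ring.
  by rewrite -(integral_trig (law P (mX k)) (K w) (p w) (q w) (wt U k w)).
have w01 w : 0 <= wt U k w <= 1 by rewrite wt_ge0 (wt_le1 _ _ kw).
apply: le_trans (IH _ _ (fun w => r w * (1 - c * wt U k w)) us sw mK _ _ _ _ _) _.
- by apply: measurable_funD; exact: measurable_funM.
- by apply: measurable_funB; exact: measurable_funM.
- apply: measurable_funM => //; apply: measurable_funB; first exact: measurable_cst.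
  by apply: measurable_funM; [exact: measurable_cst|exact: mwt].
- move=> w; have /andP[r0 rKw] := rK w; have [cw _] := transformX k (w01 w).
  rewrite mulr_ge0 ?subr_ge0//=; apply: le_trans rKw.
  by rewrite ler_piMr// gerBl mulr_ge0// wt_ge0.
- move=> w; have [_ tw] := transformX k (w01 w).
  rewrite exprMn.
  have -> : (a w * al w + b w * be w) ^+ 2 + (b w * al w - a w * be w) ^+ 2 =
    (a w ^+ 2 + b w ^+ 2) * (al w ^+ 2 + be w ^+ 2) by ring.
  by apply: ler_pM => //; rewrite addr_ge0 ?sqr_ge0.
under eq_integral do rewrite -mulrA.
by under [leRHS]eq_integral do rewrite big_cons.
Qed.

End peeling.

(** * The case sigma > 0 *)

Section cauchy_component.
Context (R : realType) d (Om : measurableType d) (P : probability Om R).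
Variables U X : seq bool -> Om -> R.
Variables (nu : probability R R) (m sigma : R).
Hypothesis sigma_gt0 : 0 < sigma.
Hypothesis rtp : invariant_RTP P U X (conv_cauchy nu m sigma).

Let mU : forall i, measurable_fun setT (U i). Proof. by case: rtp. Qed.
Let mX : forall i, measurable_fun setT (X i). Proof. by case: rtp => _ [_ [_ []]]. Qed.
Let lawX : forall i A, measurable A -> P (X i @^-1` A) = conv_cauchy nu m sigma A.
Proof. by case: rtp => _ [_ [_ [_ []]]]. Qed.
Let indX n : mutually_independent P X [set i | size i = n].
Proof. by case: rtp => _ [_ [_ [_ [_ [_ /(_ n)[]]]]]]. Qed.
Let indXU n :
  independent_families P X [set i | size i = n] U [set i | (size i < n)%N].
Proof. by case: rtp => _ [_ [_ [_ [_ [_ /(_ n)[]]]]]]. Qed.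

Let c : R := 2 * sigma / (sigma ^+ 2 + (2 * pi) ^+ 2).

Let c_gt0 : 0 < c.
Proof.
by rewrite divr_gt0 ?mulr_gt0// addr_gt0// exprn_gt0// mulr_gt0// pi_gt0.
Qed.

Let transformX i s : 0 <= s <= 1 -> c * s <= 1 /\
  cos_transform (law P (mX i)) s ^+ 2 + sin_transform (law P (mX i)) s ^+ 2
    <= (1 - c * s) ^+ 2.
Proof. by apply: (conv_cauchy_transform sigma_gt0) => A mA; exact: lawX. Qed.

(** From 1 - x <= e^(-x), the weights summing to one. [transformX] makes the factors nonnegative, so
    the bounds may be multiplied. *)
Lemma prod_le_expR n w :
  \prod_(i <- words n) (1 - c * wt U i w) <= expR (- c).
Proof.
have -> : - c = \sum_(i <- words n) - (c * wt U i w).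
  by rewrite sumrN -mulr_sumr sum_wt mulr1.
rewrite expR_sum big_seq [leRHS]big_seq; apply: ler_prod => i i_w.
have w01 : 0 <= wt U i w <= 1 by rewrite wt_ge0 (wt_le1 _ _ i_w).
have [cw _] := transformX i w01.
rewrite subr_ge0 cw/=.
exact: expR_ge1Dx.
Qed.

Let mf theta : measurable_fun setT (fun w => 1 + cos (X [::] w + theta)).
Proof.
apply: measurable_funD; first exact: measurable_cst.
apply: measurableT_comp (@measurable_cos R) _.
by apply: measurable_funD; [exact: mX|exact: measurable_cst].
Qed.

Lemma onePcos_ge0 (x : R) : 0 <= 1 + cos x.
Proof. by have := cos_geN1 x; lra. Qed.

Lemma integral_cos_generation n (A : set Om) theta :
  <<s rect U [set j | (size j < n)%N] >> A ->
  (\int[P]_(w in A) (1 + cos (X [::] w + theta))%:E <= (1 + expR (- c))%:E * P A)%E.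
Proof.
move=> sA.
pose G := rect U [set j | (size j < n)%N].
have mA : measurable A.
  exact: (g_sigma_rect_measurable mU) sA.
have mK : measurable_fun (setT : set (g_sigma_algebraType G)) (\1_A : _ -> R).
  exact: measurable_indic.
pose V w := toll U n w + theta.
have mV : measurable_fun (setT : set (g_sigma_algebraType G)) V.
  apply: measurable_funD; last exact: measurable_cst.
  by apply: measurable_toll => j jn; exact: measurable_rect.
(* The cosine of [V] plus the weighted sum is expanded on [A]; both [K] and [r] are taken to be the
   indicator of [A]. *)
pose a w : R := \1_A w * cos (V w).
pose b w : R := - (\1_A w * sin (V w)).
have ma : measurable_fun (setT : set (g_sigma_algebraType G)) a.
  by apply: measurable_funM => //; exact: measurableT_comp (@measurable_cos R) mV.
have mb : measurable_fun (setT : set (g_sigma_algebraType G)) b.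
  apply: measurableT_comp; first exact: oppr_measurable.
  by apply: measurable_funM => //; exact: measurableT_comp (@measurable_sin R) mV.
have rK w : 0 <= (\1_A w : R) <= \1_A w by rewrite lexx andbT indicE; case: (w \in A).
have ab w : a w ^+ 2 + b w ^+ 2 <= (\1_A w : R) ^+ 2.
  rewrite /a /b sqrrN !exprMn -mulrDr cos2Dsin2 mulr1//.
have := integral_trig_peel mU (@indX n) (@indXU n) (ltW c_gt0) transformX
  (uniq_words n) (fun i h => h) mK ma mb mK rK ab.
set lhs := (leLHS) => le1.
have -> : (\int[P]_(w in A) (1 + cos (X [::] w + theta))%:E = lhs)%E.
  rewrite integral_mkcond /lhs; apply: ae_eq_integral => //.
  - apply/(measurable_restrictT _ mA)/measurable_funTS/measurable_EFinP.
    exact: mf.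
  - have mS : measurable_fun setT (fun w => \sum_(i <- words n) wt U i w * X i w).
      apply: measurable_sum_seq => i _; apply: measurable_funM; last exact: mX.
      by apply: (measurable_wt (n := size i)).
    apply/measurable_EFinP; apply: measurable_funD; first exact: measurable_indic.
    apply: measurable_funD; apply: measurable_funM.
    + exact: measurable_fun_rect mU ma.
    + exact: measurableT_comp (@measurable_cos R) mS.
    + exact: measurable_fun_rect mU mb.
    + exact: measurableT_comp (@measurable_sin R) mS.
  - move: (ae_tree rtp); apply: filterS => w [U01 XE] _.
    rewrite patchE (tree_expansion U01 XE n) addrAC -/(V w) cosD /a /b indicE.
    by case: ifPn => wA; rewrite ?wA ?(negbTE wA)/=; congr (_%:E); ring.
apply: le_trans le1 _.
rewrite -[X in (_ * P X)%E]setIT -integral_indic// -ge0_integralZl//; last first.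
  by apply/measurable_EFinP; exact: measurable_indic.
have prod_ge0 w : 0 <= \prod_(i <- words n) (1 - c * wt U i w).
  rewrite big_seq; apply: prodr_ge0 => i i_w.
  have w01 : 0 <= wt U i w <= 1 by rewrite wt_ge0 (wt_le1 _ _ i_w).
  by have [cw _] := transformX i w01; rewrite subr_ge0.
apply: ge0_le_integral => //.
- by move=> w _; rewrite lee_fin addr_ge0// mulr_ge0.
- apply/measurable_EFinP; apply: measurable_funD; first exact: measurable_indic.
  apply: measurable_funM; first exact: measurable_indic.
  apply: measurable_prod => i _; apply: measurable_funB; first exact: measurable_cst.
  apply: measurable_funM; first exact: measurable_cst.
  by apply: (measurable_wt (n := size i)).
- by apply: measurable_funeM; apply/measurable_EFinP; exact: measurable_indic.
- move=> w _; rewrite -EFinM lee_fin mulrDl mul1r lerD2l mulrC.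
  by rewrite ler_wpM2r// prod_le_expR.
Qed.

Let GU : set (set Om) :=
  [set E | exists i (B : set R), measurable B /\ E = U i @^-1` B].

Let gen n : set (set Om) := <<s rect U [set j | (size j < n)%N] >>.

Let gen_mono n n' : (n <= n')%N -> gen n `<=` gen n'.
Proof.
by move=> nn'; apply: sub_sigma_algebra2; apply: rectS => j /= jn; exact: leq_trans nn'.
Qed.

Let ring_gen : setring [set A | exists n, gen n A].
Proof.
have mx n n' A B : gen n A -> gen n' B -> gen (maxn n n') A /\ gen (maxn n n') B.
  by move=> gA gB; split;
    [exact: (gen_mono (leq_maxl n n'))|exact: (gen_mono (leq_maxr n n'))].
split.
- by exists 0%N; exact: (@measurable0 _ (g_sigma_algebraType _)).
- move=> A B [n gA] [n' gB]; have [gA' gB'] := mx _ _ _ _ gA gB.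
  by exists (maxn n n'); exact: (@measurableU _ (g_sigma_algebraType _)).
- move=> A B [n gA] [n' gB]; have [gA' gB'] := mx _ _ _ _ gA gB.
  by exists (maxn n n'); exact: (@measurableD _ (g_sigma_algebraType _)).
Qed.

Let sub_ring_gen : <<s GU >> `<=` <<sr [set A | exists n, gen n A] >>.
Proof.
have [sr0 srD srU] := smallest_sigma_ring [set A | exists n, gen n A].
apply: smallest_sub; first split=> //.
(* The ring contains the whole space, so its sigma-ring is closed under complement. *)
- move=> A sA; apply: srD => //; apply: sub_g_sigma_ring.
  by exists 0%N; exact: (@measurableT _ (g_sigma_algebraType _)).
- move=> _ [i [B [mB ->]]]; apply: sub_g_sigma_ring; exists (size i).+1.
  by apply: sub_sigma_algebra; apply: rect_preimage => //=.
Qed.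

(** Monotone class argument, starting from the ring of events that depend on finitely many
    generations. *)
Lemma integral_cos_gen_sigma (A : set Om) theta : <<s GU >> A ->
  (\int[P]_(w in A) (1 + cos (X [::] w + theta))%:E <= (1 + expR (- c))%:E * P A)%E.
Proof.
pose H := [set A | measurable A /\ (\int[P]_(w in A) (1 + cos (X [::] w + theta))%:E
  <= (1 + expR (- c))%:E * P A)%E].
have rho0 : 0 <= 1 + expR (- c) by rewrite addr_ge0// expR_ge0.
have mfE D : measurable_fun D (fun w => (1 + cos (X [::] w + theta))%:E).
  by apply: measurable_funTS; apply/measurable_EFinP; exact: mf.
have f0 w : (0 <= (1 + cos (X [::] w + theta))%:E)%E by rewrite lee_fin onePcos_ge0.
suff monoH : monotone H.
  move=> sA; have [] // : H A.
  apply: (monotone_setring_sub_g_sigma_ring monoH ring_gen) (sub_ring_gen sA).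
  move=> B [n gB]; split; first exact: (g_sigma_rect_measurable mU gB).
  exact: integral_cos_generation gB.
split=> F ndF HF; have mF n : measurable (F n) by have [] := HF n.
  have mU' : measurable (\bigcup_n F n) by exact: bigcup_measurable.
  split => //.
  (* Increasing unions: the integrals converge monotonically, and each P(F_n) is at most that of the
     union. *)
  have cv : (\int[P]_(w in F n) (1 + cos (X [::] w + theta))%:E @[n --> \oo] -->
      \int[P]_(w in \bigcup_n F n) (1 + cos (X [::] w + theta))%:E)%E.
    by apply: ge0_nondecreasing_set_cvg_integral.
  rewrite -(cvg_lim _ cv)//; apply: lime_le; first exact: cvgP cv.
  apply: nearW => n; have [_ /le_trans] := HF n; apply.
  by rewrite lee_wpmul2l ?lee_fin// le_measure ?inE//; exact: bigcup_sup.
have mI' : measurable (\bigcap_n F n) by exact: bigcap_measurable.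
split => //.
(* Decreasing intersections: the integral over the intersection is below every bound, and the bounds
   converge by continuity of [P]. *)
have cv : P (F n) @[n --> \oo] --> P (\bigcap_n F n).
  by apply: nonincreasing_cvg_mu => //; rewrite -ge0_fin_numE ?fin_num_measure.
have cv' : ((1 + expR (- c))%:E * P (F n) @[n --> \oo] -->
    (1 + expR (- c))%:E * P (\bigcap_n F n))%E by exact: cvgeZl.
rewrite -(cvg_lim _ cv')//; apply: lime_ge; first exact: cvgP cv'.
apply: nearW => n; have [_] := HF n; apply: le_trans.
by apply: ge0_subset_integral => //; exact: bigcap_inf.
Qed.

Lemma not_endogenous : ~ endogenous P U X.
Proof.
move=> [g [mg Xg]].
have rho1 : expR (- c) < 1 by rewrite -expR0 ltr_expR oppr_lt0.
(* Strictly between e^(-c) and 1: the lower gap makes the sets [A q] null, the upper gap lets them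
   cover the space. *)
pose rho := (1 + expR (- c)) / 2.
have rho_lt1 : rho < 1 by rewrite /rho; lra.
have rho_gt : expR (- c) < rho by rewrite /rho; lra.
have mgU : measurable_fun (setT : set (g_sigma_algebraType GU)) g.
  by move=> _ B mB; rewrite setTI; exact: mg.
(* Written with [g] instead of the root value, so as to lie in the sigma-algebra of the [U]'s;
   rational shifts keep the family countable. *)
pose A (q : rat) := [set w | rho < cos (g w + ratr q)].
have sA q : <<s GU >> (A q).
  have mh : measurable_fun (setT : set (g_sigma_algebraType GU))
      (fun w => cos (g w + ratr q)).
    apply: measurableT_comp (@measurable_cos R) _.
    by apply: measurable_funD => //; exact: measurable_cst.
  have := mh measurableT _ (@measurable_itv R `]rho, +oo[).
  rewrite setTI; congr (<<s GU >> _).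
  by apply/seteqP; split=> w /=; rewrite in_itv/= andbT.
have sGU : <<s GU >> `<=` measurable.
  apply: smallest_sub; first exact: sigma_algebra_measurable.
  by move=> _ [i [B [mB ->]]]; exact: measurable_preimageT.
have mA q : measurable (A q) by exact: sGU.
have PA0 q : P (A q) = 0%E.
  (* Almost everywhere on [A q] the root value is [g], and the integrand exceeds 1 + rho. *)
  have le1 : ((1 + rho)%:E * P (A q) <= (1 + expR (- c))%:E * P (A q))%E.
    apply: le_trans (integral_cos_gen_sigma (ratr q) (sA q)).
    rewrite -integral_cst//; apply: ae_ge0_le_integral => //.
    - by move=> w _; rewrite lee_fin addr_ge0// (le_trans _ (ltW rho_gt))// expR_ge0.
    - by apply: measurable_funTS; apply/measurable_EFinP; exact: mf.
    - move: Xg; apply: filterS => w -> Aw.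
      by rewrite lee_fin lerD2l ltW.
  have Pfin : P (A q) \is a fin_num by rewrite fin_num_measure.
  move: le1; rewrite -(fineK Pfin) -!EFinM lee_fin => le1.
  have Pge0 : 0 <= fine (P (A q)) by exact: fine_ge0.
  congr (_%:E); apply/eqP; rewrite eq_le Pge0 andbT.
  rewrite leNgt; apply/negP => Pgt0.
  by move: le1; rewrite ler_pM2r// lerD2l leNgt rho_gt.
have aeA : {ae P, forall w, forall q, ~ A q w}.
  apply: ae_forall_countable => q; exists (A q); split => //.
  by move=> w /= h; apply: contrapT.
have [N [mN PN0 subN]] := aeA.
(* A rational close enough to [- g w] brings the cosine above [rho], so every point is in some [A q]
   and the null set [N] is everything. *)
have NT : N = setT.
  apply/seteqP; split=> // w _; apply: subN => /= h.
  have cr : rho < cos 0 by rewrite cos0.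
  have : \forall t \near (0 : R), rho < cos t.
    exact: (cvgr_gt (cos 0) (@continuous_cos R 0) _ cr).
  move=> [e /= e0 he].
  have [q] : exists q, ratr q \in `](- g w - e), (- g w + e)[.
    by apply: rat_in_itvoo; lra.
  rewrite in_itv/= => /andP[q1 q2].
  apply: (h q); rewrite /A/=; apply: he => /=.
  by rewrite sub0r normrN ltr_norml; apply/andP; split; lra.
have : P setT = 1%E by exact: probability_setT.
by rewrite -NT PN0 => /eqP; rewrite eq_sym onee_eq0.
Qed.

End cauchy_component.

Unset Implicit Arguments.

Theorem theorem21 (R : realType) (nu : probability R R) (m sigma : R)
    (d : measure_display) (Omega : measurableType d) (P : probability Omega R)
    (U X : seq bool -> Omega -> R) :
  quicksort_RDE_solution nu ->
  nu.-integrable setT (fun x => x%:E) ->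
  (\int[nu]_x x%:E = 0)%E ->
  (\int[nu]_x (x ^+ 2)%:E < +oo)%E ->
  0 <= sigma ->
  invariant_RTP P U X (conv_cauchy nu m sigma) ->
  (endogenous P U X <-> sigma = 0).
Proof.
move=> _ i1 m0 v0 sigma0 rtp; split=> [endo|s0].
  apply: contrapT => /eqP s0; apply: not_endogenous rtp endo.
  by rewrite lt_neqAle eq_sym s0.
by rewrite s0 in rtp; exact: endogenous0 i1 m0 v0 rtp.
Qed.
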